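(* Let $F_1,F_2$ be complex square matrices of the same order such that $F_1^*+F_2p$ and $F_2^*+F_1p$ commute for every $p\in\mathbb C$, and suppose that $$\Lambda=\{(s_1,s_2,p)\in\mathbb G_3:(s_1,s_2)\in\sigma_T(F_1^*+F_2p,\,F_2^*+F_1p)\}$$ is a distinguished variety in $\mathbb G_3$. Then $W=\phi(\Lambda)$ is a distinguished variety in $\mathbb G_2$, where $\phi$ is the holomorphic map $$\phi:\mathbb G_3\to\mathbb G_2,\qquad (s_1,s_2,p)\mapsto\left(\frac{s_1}{3}+\frac{s_2}{3},\,p\right).$$
   Context: $\mathbb D$ is the open unit disc, $\mathbb T$ the unit circle. $\pi_n(z)=\big(\sum_i z_i,\sum_{i<j}z_iz_j,\dots,\prod_iz_i\big)$ is the symmetrization map on $\mathbb C^n$; $\mathbb G_n=\pi_n(\mathbb D^n)$, $\Gamma_n=\overline{\mathbb G_n}=\pi_n(\overline{\mathbb D}^n)$, $b\Gamma_n=\pi_n(\mathbb T^n)$ (distinguished boundary), $\partial\Gamma_n=\Gamma_n\setminus\mathbb G_n$. So $\mathbb G_2=\{(z_1+z_2,z_1z_2):|z_i|<1\}$ and $\mathbb G_3=\{(z_1+z_2+z_3,z_1z_2+z_2z_3+z_3z_1,z_1z_2z_3):|z_i|<1\}$. For commuting complex square matrices of the same size, $\sigma_T$ (the Taylor joint spectrum) is the set of joint eigenvalues. A distinguished set in $\mathbb G_n$ is a set $\Lambda=\mathbb G_n\cap V$, where $V\subset\mathbb C^n$ is an algebraic set of complex dimension $>0$ such that, with $\overline\Lambda:=V\cap\Gamma_n$,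 $\overline\Lambda\cap\partial\Gamma_n=\overline\Lambda\cap b\Gamma_n$. A distinguished variety is an irreducible distinguished set. *)

(* Defs.v *)
From mathcomp Require Import all_boot all_order all_algebra.
From mathcomp Require Import sesquilinear spectral complex ring lra.
From mathcomp Require Import boolp classical_sets functions.
From mathcomp Require Import reals constructive_ereal ereal.
From mathcomp Require mpoly.

Set Implicit Arguments.
Unset Strict Implicit.
Unset Printing Implicit Defensive.

Import Order.TTheory GRing.Theory Num.Theory.
Local Open Scope classical_set_scope.
Local Open Scope ring_scope.
Local Open Scope sesquilinear_scope.

Section Definitions.
Variable R : realType.
Local Notation C := R[i].

Definition symmetrization n (z : 'rV[C]_n) : 'rV[C]_n :=
  \row_(k < n) mpoly.meval (z 0) (mpoly.mesym n C k.+1).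

Unset Implicit Arguments.

Definition polydisc n : set 'rV[C]_n := [set z | forall i, `|z 0 i| < 1].
Definition closed_polydisc n : set 'rV[C]_n :=
  [set z | forall i, `|z 0 i| <= 1].
Definition torus n : set 'rV[C]_n := [set z | forall i, `|z 0 i| = 1].

Definition GG n : set 'rV[C]_n := [set symmetrization z | z in polydisc n].
Definition Gamma n : set 'rV[C]_n :=
  [set symmetrization z | z in closed_polydisc n].
Definition bGamma n : set 'rV[C]_n := [set symmetrization z | z in torus n].
Definition dGamma n : set 'rV[C]_n := Gamma n `\` GG n.

Set Implicit Arguments.

Definition algebraic_set n (V : set 'rV[C]_n) : Prop :=
  exists I : set (mpoly.mpoly n C),
    V = [set x | forall f, I f -> mpoly.meval (x 0) f = 0].

(* Irreducibility in the subspace topology induced by the Zariski topology;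
   it also applies to sets, such as V `&` GG n, that are not closed in C^n. *)
Definition zariski_irreducible n (S : set 'rV[C]_n) : Prop :=
  S !=set0 /\
  forall A B : set 'rV[C]_n, algebraic_set A -> algebraic_set B ->
    S `<=` A `|` B -> S `<=` A \/ S `<=` B.

Definition irreducible_chain n (V : set 'rV[C]_n) (d : nat)
    (Z : nat -> set 'rV[C]_n) : Prop :=
  (forall i, (i <= d)%N ->
     [/\ algebraic_set (Z i), zariski_irreducible (Z i) & Z i `<=` V]) /\
  (forall i, (i < d)%N -> Z i `<` Z i.+1).

(* The complex dimension of an algebraic set, as its Krull dimension; the empty
   set has dimension -oo. *)
Definition alg_dim n (V : set 'rV[C]_n) : \bar R :=
  ereal_sup [set (d%:R%:E : \bar R) | d in
               [set d : nat | exists Z, irreducible_chain V d Z]].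

Definition distinguished_set n (L : set 'rV[C]_n) : Prop :=
  exists V : set 'rV[C]_n,
    [/\ algebraic_set V, (0 < alg_dim V)%E, L = GG n `&` V
      & (V `&` Gamma n) `&` dGamma n = (V `&` Gamma n) `&` bGamma n].

Definition distinguished_variety n (L : set 'rV[C]_n) : Prop :=
  distinguished_set L /\ zariski_irreducible L.

(* For commuting A and B this is the Taylor joint spectrum. *)
Definition joint_spectrum m (A B : 'M[C]_m) : set (C * C) :=
  [set l | exists v : 'cV[C]_m,
     [/\ v != 0, A *m v = l.1 *: v & B *m v = l.2 *: v]].

(* For x : 'rV_3, the coordinates x 0 0, x 0 1, x 0 2 are s1, s2, p. *)
Definition Lambda m (F1 F2 : 'M[C]_m) : set 'rV[C]_3 :=
  [set x | GG 3 x /\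
     joint_spectrum (F1 ^t* + x 0 2 *: F2) (F2 ^t* + x 0 2 *: F1)
       (x 0 0, x 0 1)].

Definition phi (x : 'rV[C]_3) : 'rV[C]_2 :=
  \row_(i < 2) [:: x 0 0 / 3 + x 0 1 / 3; x 0 2]`_i.

Let symmE n (z : 'rV[C]_n) (k : 'I_n) :
  (-1) ^+ k.+1 * symmetrization z 0 k =
  (\prod_(i < n) ('X - (z 0 i)%:P))`_(n - k.+1).
Proof.
have hk : (k.+1 < n.+1)%N by rewrite ltnS ltn_ord.
pose cs := mktuple (fun i => z 0 i).
have H := mpoly.mroots_coeff cs (Ordinal hk).
rewrite big_tuple in H.
transitivity (\prod_(i < n) ('X - (tnth cs i)%:P))`_(n - k.+1); last first.
  by congr (polyseq _)`_ _; apply: eq_bigr => i _; rewrite tnth_mktuple.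
rewrite [RHS]H mxE !mpoly.mevalE; congr (_ * _); apply: eq_bigr => m _.
by congr (_ * _); apply: eq_bigr => i _; rewrite tnth_mktuple.
Qed.

Lemma symmetrization2E (z : 'rV[C]_2) :
  symmetrization z = \row_(i < 2) [:: z 0 0 + z 0 1; z 0 0 * z 0 1]`_i.
Proof.
have E : \prod_(i < 2) ('X - (z 0 i)%:P) =
    'X^2 - (z 0 0 + z 0 1) *: 'X + (z 0 0 * z 0 1)%:P.
  rewrite !big_ord_recl big_ord0 mulr1.
  rewrite (_ : lift ord0 ord0 = 1); last exact/val_inj.
  by rewrite -!mul_polyC polyCD polyCM; ring.
have H := symmE z; rewrite E in H.
apply/rowP => k; rewrite [RHS]mxE; apply: (mulfI (_ : (-1) ^+ k.+1 != 0 :> C)).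
  by rewrite signr_eq0.
rewrite [LHS]H !coefE; case: k {H} => [] [|[|//]] hk /=; ring.
Qed.

Lemma symmetrization3E (z : 'rV[C]_3) :
  symmetrization z =
  \row_(i < 3) [:: z 0 0 + z 0 1 + z 0 2;
                   z 0 0 * z 0 1 + z 0 1 * z 0 2 + z 0 2 * z 0 0;
                   z 0 0 * z 0 1 * z 0 2]`_i.
Proof.
have E : \prod_(i < 3) ('X - (z 0 i)%:P) =
    'X^3 - (z 0 0 + z 0 1 + z 0 2) *: 'X^2
    + (z 0 0 * z 0 1 + z 0 1 * z 0 2 + z 0 2 * z 0 0) *: 'X
    - (z 0 0 * z 0 1 * z 0 2)%:P.
  rewrite !big_ord_recl big_ord0 mulr1.
  rewrite (_ : lift ord0 ord0 = 1); last exact/val_inj.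
  rewrite (_ : lift ord0 _ = 2); last exact/val_inj.
  by rewrite -!mul_polyC !polyCD !polyCM; ring.
have H := symmE z; rewrite E in H.
apply/rowP => k; rewrite [RHS]mxE; apply: (mulfI (_ : (-1) ^+ k.+1 != 0 :> C)).
  by rewrite signr_eq0.
rewrite [LHS]H !coefE; case: k {H} => [] [|[|[|//]]] hk /=; ring.
Qed.

Let sum_bound (x y : C) : 0 <= x -> x < 1 -> 0 <= y -> y < 1 ->
  x * (1 - y ^+ 2) + y * (1 - x ^+ 2) < 1 - (x * y) ^+ 2.
Proof.
move=> x0 x1 y0 y1; rewrite -subr_gt0.
have -> : 1 - (x * y) ^+ 2 - (x * (1 - y ^+ 2) + y * (1 - x ^+ 2)) =
  (1 - x) * (1 - y) * (1 - x * y) by ring.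
by rewrite !mulr_gt0 ?subr_gt0 // mulr_ilt1.
Qed.

Let term_bound (a d : C) : `|a| < 1 -> `|d| < 1 ->
  `|a * (1 - `|d| ^+ 2) + d * (1 - `|a| ^+ 2)| < 1 - (`|a| * `|d|) ^+ 2.
Proof.
move=> ha hd; apply: le_lt_trans (sum_bound _ ha _ hd) => //.
apply: (le_trans (ler_normD _ _)); rewrite !normrM.
by rewrite !(ger0_norm (x := 1 - _)) // subr_ge0 exprn_ile1 // ltW.
Qed.

Let root_bound (x y : C) :
  `|x + y - (x + y)^* * (x * y)| < 1 - (`|x| * `|y|) ^+ 2 ->
  `|x| * `|y| < 1 -> `|x| < 1.
Proof.
move=> hk hxy; rewrite real_ltNge ?normr_real //; apply/negP => x1.
have y1 : `|y| < 1.
  by apply: le_lt_trans hxy; rewrite ler_peMl.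
have E : x + y - (x + y)^* * (x * y) =
    x * (1 - `|y| ^+ 2) - y * (`|x| ^+ 2 - 1).
  by rewrite !normCK rmorphD /=; ring.
rewrite E in hk; have := le_lt_trans (lerB_dist _ _) hk.
rewrite !normrM (ger0_norm (x := 1 - _)); last first.
  by rewrite subr_ge0 exprn_ile1 // ltW.
rewrite (ger0_norm (x := _ - 1)); last by rewrite subr_ge0 exprn_ege1.
move/lt_geF/negbT/negP; apply.
rewrite -subr_ge0.
set X := `|x| in x1 hxy *; set Y := `|y| in y1 hxy *.
have -> : X * (1 - Y ^+ 2) - Y * (X ^+ 2 - 1) - (1 - (X * Y) ^+ 2) =
  (X - 1) * (1 - Y) * (1 - X * Y) by ring.
by rewrite !mulr_ge0 // subr_ge0 // ltW.
Qed.

(* phi is indeed a map from GG 3 to GG 2. The bounds rest on the identity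
   |u + v - (u + v)^* u v| = |u (1 - |v|^2) + v (1 - |u|^2)|. *)
Lemma phi_GG : set_fun (GG 3) (GG 2) phi.
Proof.
move=> _ [z hz <-]; rewrite /phi symmetrization3E.
move: (hz 0) (hz 1) (hz 2); rewrite !mxE /=.
move: (z 0 0) (z 0 1) (z 0 2) => a b c {z hz} ha hb hc.
set s1 := a + b + c; set s2 := a * b + b * c + c * a; set p := a * b * c.
set s := s1 / 3 + s2 / 3.
have [t ht] : exists t : C, t ^+ 2 = s ^+ 2 - 4 * p.
  by exists (sqrtC (s ^+ 2 - 4 * p)); rewrite sqrtCK.
pose u := (s + t) / 2; pose v := (s - t) / 2.
have huv : u + v = s by rewrite /u /v; field.
have hp : u * v = p.
  have -> : u * v = (s ^+ 2 - t ^+ 2) / 4 by rewrite /u /v; field.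
  by rewrite ht; field.
have hbc : `|b * c| < 1 by rewrite normrM mulr_ilt1.
have hca : `|c * a| < 1 by rewrite normrM mulr_ilt1.
have hab : `|a * b| < 1 by rewrite normrM mulr_ilt1.
have habc : `|a| * `|b| * `|c| < 1 by rewrite -normrM mulr_ilt1.
have key : `|s - s^* * p| < 1 - (`|a| * `|b| * `|c|) ^+ 2.
  have -> : s - s^* * p =
      ((a * (1 - `|b * c| ^+ 2) + (b * c) * (1 - `|a| ^+ 2)) +
       (b * (1 - `|c * a| ^+ 2) + (c * a) * (1 - `|b| ^+ 2)) +
       (c * (1 - `|a * b| ^+ 2) + (a * b) * (1 - `|c| ^+ 2))) / 3.
    by rewrite !normCK /s /s1 /s2 /p !(rmorphD, rmorphM, fmorphV, rmorph_nat) /=;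
       field.
  rewrite normrM normfV (ger0_norm (x := 3)) // ltr_pdivrMr //.
  rewrite (_ : (_ - _) * 3 = (1 - (`|a| * `|b * c|) ^+ 2) +
    (1 - (`|b| * `|c * a|) ^+ 2) + (1 - (`|c| * `|a * b|) ^+ 2)); last first.
    by rewrite !normrM; ring.
  apply: (le_lt_trans (ler_normD _ _)); apply: ltrD; last exact: term_bound.
  by apply: (le_lt_trans (ler_normD _ _)); apply: ltrD; exact: term_bound.
have main x y : x + y = s -> x * y = p -> `|x| < 1.
  move=> hs hxy; have nxy : `|x| * `|y| = `|a| * `|b| * `|c|.
    by rewrite -!normrM hxy.
  by apply: (@root_bound x y); rewrite ?hs ?hxy nxy.
exists (\row_(i < 2) [:: u; v]`_i).
  move=> i; rewrite mxE; case: i => [] [|[|//]] hi /=.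
    exact: (main u v).
  by apply: (main v u); rewrite 1?addrC 1?mulrC.
by rewrite symmetrization2E; apply/rowP => i; rewrite !mxE /= huv hp.
Qed.
End Definitions.

(* Main.v *)
Require Import Defs.
From mathcomp Require Import all_boot all_order all_algebra.
From mathcomp Require Import sesquilinear spectral complex.
From mathcomp Require Import boolp classical_sets functions.
From mathcomp Require Import reals constructive_ereal ereal.
From mathcomp Require Import filter ring lra zify.
From mathcomp Require mpoly.

Set Implicit Arguments.
Unset Strict Implicit.
Unset Printing Implicit Defensive.

Import Order.TTheory GRing.Theory Num.Theory.
Local Open Scope classical_set_scope.
Local Open Scope ring_scope.
Local Open Scope sesquilinear_scope.

(** Let W be the image of Lambda, in the coordinates (s, p). The Zariski
    closure of W is a curve q = 0, with q irreducible and, by Gauss's lemma,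
    monic in s, because s is an eigenvalue of one third of the sum of the two
    given pencils. The theorem amounts to saying that this curve has no other
    point than W over the open disc |p| < 1 ([curve_over_disc]): a point of
    Gamma_2 with |p| = 1 belongs to bGamma_2, and irreducibility is inherited
    by W and by its closure.

    Three facts on W are used. It is closed over the open disc, since a limit
    of points of Lambda stays in Gamma_3 and can only leave G_3 through the
    distinguished boundary, where |p| = 1 ([distinguished_lim]). It is open in
    the curve, since G_3 is open and the joint eigenvalues of a commuting
    pencil move continuously ([Lambda_follow]). Finally, for |p| = 1 the second
    pencil is p times the adjoint of the first, so that the curve is real over
    the unit circle: s = p conj(s) there ([pencil_circle]).

    The curve might still have several sheets over the disc that only meet
    along the circle, W being the union of some of them. This is excluded as
    for the two halves of a real curve of dividing type. Suppose that over a
    generic p0 some of the n points of the curve are missing from W. Polynomials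
    g(p, s) of degree less than n in s and about 2k in p have about 2kn
    coefficients, and asking that g and its reflection in the circle vanish to
    order k + 1 along the fewer than n branches of W through p0 costs at most
    2(n - 1)(k + 1) conditions. For large k there is thus a nonzero solution,
    and g yields functions f = G / D on the curve, with
    D = ((p - p0)(1 - conj(p0) p))^k, that are real over the circle and have no
    pole on W ([full_fibre]). The maximum principle forces the imaginary part
    of f to vanish on W ([Im_le0]), while a nonconstant f takes values in all
    directions near a point of W ([Im_increase]). So f is constant and, having
    a zero, it is 0; this contradicts the choice of g.

    Sequences are taken along a fixed ultrafilter, so that bounded sequences
    converge, and the branches of the curve are only used through polynomial
    arcs that follow them to a prescribed finite order ([hensel], [ev_arc]). *)

(** * Limits along an ultrafilter *)

Section UltraLimit.
Variable R : realType.
Local Notation C := R[i].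
Variable U : set_system nat.
Context {UU : UltraFilter U}.
Hypothesis leU : eventually `<=` U.

Definition ulim (u : nat -> C) (l : C) :=
  forall e : C, 0 < e -> U [set j | `|u j - l| < e].

Lemma ultra_em (A : set nat) : U A \/ U (~` A).
Proof. exact: in_ultra_setVsetC. Qed.

Lemma ultra_ex (A : set nat) : U A -> exists j, A j.
Proof. by move=> /filter_ex. Qed.

Lemma ultra_and (A B : set nat) : U A -> U B -> exists2 j, A j & B j.
Proof. by move=> UA /(filterI UA) /ultra_ex[j []]; exists j. Qed.

Lemma ulim_cst (c : C) : ulim (fun=> c) c.
Proof.
by move=> e e0; apply: filterS filterT => j _ /=; rewrite subrr normr0.
Qed.

Lemma ulim_near (u v : nat -> C) l :
  U [set j | u j = v j] -> ulim u l -> ulim v l.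
Proof.
move=> uv ul e /ul; apply: filterS2 uv => j /= -> //.
Qed.

Lemma ulimD u v a b : ulim u a -> ulim v b -> ulim (fun j => u j + v j) (a + b).
Proof.
move=> ua vb e e0; have e20 : 0 < e / 2 by rewrite divr_gt0.
apply: filterS2 (ua _ e20) (vb _ e20) => j /= h1 h2.
rewrite opprD addrACA (splitr e).
by apply: le_lt_trans (ltrD h1 h2); apply: ler_normD.
Qed.

Lemma ulim_bounded u a : ulim u a ->
  exists2 M : C, 0 < M & U [set j | `|u j| < M].
Proof.
move=> ua; exists (`|a| + 1); first by rewrite ltr_wpDl.
apply: filterS (ua _ ltr01) => j /= h.
by rewrite -(subrK a (u j)) addrC (le_lt_trans (ler_normD _ _))// ltrD2l.
Qed.

Lemma ulim0M u v b : ulim u 0 -> ulim v b -> ulim (fun j => u j * v j) 0.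
Proof.
move=> u0 /ulim_bounded[M M0 vM] e e0.
apply: filterS2 (u0 _ (divr_gt0 e0 M0)) vM => j /=; rewrite !subr0 => h1 h2.
by rewrite normrM -(divfK (lt0r_neq0 M0) e) ltr_pM.
Qed.

Lemma ulimN u a : ulim u a -> ulim (fun j => - u j) (- a).
Proof. by move=> ua e /ua; apply: filterS => j /=; rewrite -opprD normrN. Qed.

Lemma ulimB u v a b : ulim u a -> ulim v b -> ulim (fun j => u j - v j) (a - b).
Proof. by move=> ua /ulimN; exact: ulimD. Qed.

Lemma ulim_sub0 u a : ulim u a -> ulim (fun j => u j - a) 0.
Proof. by move=> /ulimB/(_ (ulim_cst a)); rewrite subrr. Qed.

Lemma ulimM u v a b : ulim u a -> ulim v b -> ulim (fun j => u j * v j) (a * b).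
Proof.
move=> ua vb.
have h1 := ulim0M (ulim_sub0 ua) vb.
have h2 := ulim0M (ulim_sub0 vb) (ulim_cst a).
have := ulimD (ulimD h1 h2) (ulim_cst (a * b)); rewrite addr0 add0r.
by apply: ulim_near; near=> j; rewrite /=; ring.
Unshelve. all: by end_near. Qed.

Lemma ulimX u a k : ulim u a -> ulim (fun j => u j ^+ k) (a ^+ k).
Proof.
move=> ua; elim: k => [|k IH]; first exact: ulim_cst.
have := ulimM ua IH; rewrite -exprS; apply: ulim_near.
by near=> j; rewrite /= exprS.
Unshelve. all: by end_near. Qed.

Lemma ulim_sum (I : Type) (r : seq I) (P : pred I) (u : I -> nat -> C) a :
  (forall i, ulim (u i) (a i)) ->
  ulim (fun j => \sum_(i <- r | P i) u i j) (\sum_(i <- r | P i) a i).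
Proof.
move=> ua; elim: r => [|i r IH].
  rewrite big_nil; apply: ulim_near (ulim_cst 0).
  by near=> j; rewrite /= big_nil.
rewrite big_cons; case: ifP => Pi.
  apply: ulim_near (ulimD (ua i) IH); near=> j.
  by rewrite /= big_cons Pi.
by apply: ulim_near IH; near=> j; rewrite /= big_cons Pi.
Unshelve. all: by end_near. Qed.

Lemma ulim_prod (I : Type) (r : seq I) (P : pred I) (u : I -> nat -> C) a :
  (forall i, ulim (u i) (a i)) ->
  ulim (fun j => \prod_(i <- r | P i) u i j) (\prod_(i <- r | P i) a i).
Proof.
move=> ua; elim: r => [|i r IH].
  rewrite big_nil; apply: ulim_near (ulim_cst 1).
  by near=> j; rewrite /= big_nil.
rewrite big_cons; case: ifP => Pi.
  apply: ulim_near (ulimM (ua i) IH); near=> j.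
  by rewrite /= big_cons Pi.
by apply: ulim_near IH; near=> j; rewrite /= big_cons Pi.
Unshelve. all: by end_near. Qed.

Lemma ulim_uniq u a b : ulim u a -> ulim u b -> a = b.
Proof.
move=> ua ub; apply/eqP; rewrite -subr_eq0 -normr_eq0; apply/negPn/negP => ab.
have e0 : 0 < `|a - b| by rewrite lt_def ab normr_ge0.
have [j /=] := ultra_ex (ulimB ub ua e0).
by rewrite subrr sub0r normrN distrC ltxx.
Qed.

Lemma ulim_norm u a : ulim u a -> ulim (fun j => `|u j|) `|a|.
Proof.
move=> ua e /ua; apply: filterS => j /= h; apply: le_lt_trans h.
exact: ler_dist_dist.
Qed.

Lemma ulim_le u a (M : C) : M \is Num.real -> ulim u a ->
  U [set j | `|u j| <= M] -> `|a| <= M.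
Proof.
move=> rM /ulim_norm ua uM; rewrite real_leNgt ?normr_real//; apply/negP => Ma.
have e0 : 0 < `|a| - M by rewrite subr_gt0.
have [j /= h1 h2] := ultra_and (ua _ e0) uM.
have d0 : 0 <= `|a| - `|u j| by rewrite subr_ge0 (le_trans h2)// ltW.
move: h1; rewrite distrC ger0_norm// ltrD2l ltrN2 => /lt_le_trans/(_ h2).
by rewrite ltxx.
Qed.

Lemma ulim_neq0 u a : a != 0 -> ulim u a -> U [set j | `|a| / 2 < `|u j|].
Proof.
move=> a0 ua; have e0 : 0 < `|a| / 2 by rewrite divr_gt0 ?normr_gt0.
apply: filterS (ua _ e0) => j /=; rewrite distrC => h.
have := le_lt_trans (lerB_dist a (u j)) h.
by rewrite ltrBlDl [X in X < _](splitr `|a|) ltrD2r.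
Qed.

Lemma ulimV u a : a != 0 -> ulim u a -> ulim (fun j => (u j)^-1) a^-1.
Proof.
move=> a0 ua.
have na0 : 0 < `|a| by rewrite normr_gt0.
have un0 := ulim_neq0 a0 ua.
move=> e e0; have d0 : 0 < e * (`|a| * (`|a| / 2)).
  by rewrite mulr_gt0// mulr_gt0// divr_gt0.
apply: filterS2 un0 (ua _ d0) => j /= h1 h2.
have u0 : u j != 0 by rewrite -normr_gt0 (lt_trans _ h1)// divr_gt0.
have -> : (u j)^-1 - a^-1 = (a - u j) / (a * u j) by field; rewrite a0 u0.
rewrite normrM normfV distrC ltr_pdivrMr ?normr_gt0 ?mulf_neq0//.
apply: (lt_trans h2); rewrite normrM ltr_pM2l// ltr_pM2l//.
Qed.

Lemma ulim0_root u k : ulim (fun j => u j ^+ k.+1) 0 -> ulim u 0.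
Proof.
move=> uk e e0; apply: filterS (uk _ (exprn_gt0 k.+1 e0)) => j /=.
by rewrite !subr0 normrX ltr_pXn2r// nnegrE ?normr_ge0// ltW.
Qed.

Lemma ulim0_le u v : ulim v 0 -> U [set j | `|u j| <= `|v j|] -> ulim u 0.
Proof.
move=> v0 uv e /v0; apply: filterS2 uv => j /= h; rewrite !subr0.
exact: le_lt_trans.
Qed.

Lemma cReal_norm (x : R) : `|x%:C%C : C| = (`|x|)%:C%C.
Proof. by rewrite normc_def /= expr0n addr0 sqrtr_sqr. Qed.

Lemma gt0_cReal (e : C) : 0 < e -> exists2 r : R, e = r%:C%C & 0 < r.
Proof. by case: e => a b; rewrite ltcE /= => /andP[/eqP -> a0]; exists a. Qed.

(** The Bolzano-Weierstrass property. An ultrafilter makes the extraction of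
    subsequences superfluous: the limit is the supremum of the x such that
    x <= u j for almost all j. *)
Lemma ulim_real_ex (u : nat -> R) (M : R) : (forall j, `|u j| <= M) ->
  exists l, ulim (fun j => (u j)%:C%C) l%:C%C.
Proof.
move=> uM; pose A := [set x : R | U [set j | x <= u j]].
have A0 : A (- M).
  apply: filterS filterT => j _ /=.
  by have := uM j; rewrite ler_norml => /andP[].
have AM x : A x -> x <= M.
  move=> /ultra_ex[j /= xu]; apply: le_trans xu _.
  by have := uM j; rewrite ler_norml => /andP[].
have sA : has_sup A by split; [exists (- M) | exists M; exact: AM].
exists (sup A) => _ /gt0_cReal[e -> e0].
have [x Ax xs] := sup_adherent e0 sA.
have Ux : U [set j | u j < sup A + e / 2].
  case: (ultra_em [set j | sup A + e / 2 <= u j]) => [As|].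
    by have := ub_le_sup sA.2 As; rewrite gerDl leNgt divr_gt0.
  by apply: filterS => j /= /negP; rewrite -ltNge.
apply: filterS2 Ax Ux => j /= h1 h2.
rewrite -raddfB cReal_norm ltcR ltr_norml; move: (sup A) xs h1 h2 => S xs h1 h2.
by apply/andP; split; lra.
Qed.

Lemma Re_norm (z : C) : `|complex.Re z| <= complex.Re `|z|.
Proof. by case: z => a b /=; rewrite -sqrtr_sqr ler_wsqrtr// lerDl sqr_ge0. Qed.
Lemma Im_norm (z : C) : `|complex.Im z| <= complex.Re `|z|.
Proof. by case: z => a b /=; rewrite -sqrtr_sqr ler_wsqrtr// lerDr sqr_ge0. Qed.

Lemma ulim_ex (u : nat -> C) (M : C) : (forall j, `|u j| <= M) ->
  exists l, ulim u l.
Proof.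
move=> uM.
have RM j : complex.Re `|u j| <= complex.Re M.
  by have := uM j; rewrite lecE => /andP[].
have [a ha] := @ulim_real_ex (fun j => complex.Re (u j)) (complex.Re M)
  (fun j => le_trans (Re_norm _) (RM j)).
have [b hb] := @ulim_real_ex (fun j => complex.Im (u j)) (complex.Re M)
  (fun j => le_trans (Im_norm _) (RM j)).
exists (a%:C%C + 'i%C * b%:C%C).
apply: ulim_near (ulimD ha (ulimM (ulim_cst 'i%C) hb)).
by near=> j; rewrite /= [RHS]complexE.
Unshelve. all: by end_near. Qed.

Lemma ulim_ex_near (u : nat -> C) (M : C) : U [set j | `|u j| <= M] ->
  exists l, ulim u l.
Proof.
move=> uM; have [j0 /= uM0] := ultra_ex uM.
have [j|l ul] := @ulim_ex (fun j => if `|u j| <= M then u j else 0) M.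
  by case: ifP => // _; rewrite normr0 (le_trans _ uM0)//.
by exists l; apply: ulim_near ul; apply: filterS uM => j /= ->.
Qed.

Lemma ulim_Im u a : ulim u a ->
  ulim (fun j => (complex.Im (u j))%:C%C) (complex.Im a)%:C%C.
Proof.
move=> ua e /[dup] /ua h /gt0_cReal[r er r0]; rewrite er in h *.
apply: filterS h => j /= h.
have hj : complex.Re `|u j - a| < r by move: h; rewrite ltcE => /andP[].
rewrite -!raddfB cReal_norm ltcR.
exact: le_lt_trans (Im_norm _) hj.
Qed.

Lemma ulim_Im_gt u a (x : R) : ulim u a -> x < complex.Im a ->
  U [set j | x < complex.Im (u j)].
Proof.
move=> /ulim_Im ua xa.
have e0 : 0 < (complex.Im a - x)%:C%C :> C by rewrite ltcR subr_gt0.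
apply: filterS (ua _ e0) => j /=; rewrite -raddfB cReal_norm ltcR ltr_norml.
lra.
Qed.

Lemma ulim_inv_nat : ulim (fun j => (j.+1%:R)^-1) 0.
Proof.
move=> _ /gt0_cReal[e -> e0]; apply: leU.
have [N hN] : exists N : nat, e^-1 < N%:R.
  by exists (Num.bound e^-1); apply: archi_boundP; rewrite invr_ge0 ltW.
exists N => // j /= Nj; rewrite subr0.
have -> : (j.+1%:R^-1 : C) = (j.+1%:R^-1)%:C%C by rewrite fmorphV rmorph_nat.
rewrite cReal_norm ltcR ger0_norm ?invr_ge0// invf_plt ?posrE ?ltr0n//.
by apply: lt_le_trans hN _; rewrite ler_nat ltnW.
Qed.

End UltraLimit.

Lemma seq_argmin (D : numDomainType) (T : eqType) (r : seq T) (f : T -> D) :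
  (forall x, f x \is Num.real) -> (0 < size r)%N ->
  exists2 x, x \in r & forall y, y \in r -> f x <= f y.
Proof.
move=> fR; elim: r => // z [|z' l] IH _.
  by exists z; rewrite ?mem_head// => y; rewrite inE => /eqP->.
have [x xl hx] := IH isT; have := real_leVge (fR z) (fR x).
move=> /orP[le|le]; [exists z | exists x]; rewrite ?mem_head//.
- by move=> y; rewrite inE => /predU1P[->//|/hx]; apply: le_trans.
- by rewrite inE xl orbT.
- by move=> y; rewrite inE => /predU1P[->//|/hx].
Qed.

(** * Plane polynomials: the outer variable is s, the inner one p *)

Section PlanePoly.
Variable R : realType.
Local Notation C := R[i].
Implicit Types (F G Q : {poly {poly C}}) (p s : C).

Definition ev F p s : C := F.[s%:P].[p].

Lemma evD F G p s : ev (F + G) p s = ev F p s + ev G p s.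
Proof. by rewrite /ev !hornerD. Qed.
Lemma evN F p s : ev (- F) p s = - ev F p s.
Proof. by rewrite /ev !hornerN. Qed.
Lemma evB F G p s : ev (F - G) p s = ev F p s - ev G p s.
Proof. by rewrite evD evN. Qed.
Lemma evM F G p s : ev (F * G) p s = ev F p s * ev G p s.
Proof. by rewrite /ev !hornerM. Qed.
Lemma evC (c : {poly C}) p s : ev c%:P p s = c.[p].
Proof. by rewrite /ev hornerC. Qed.
Lemma evX p s : ev 'X p s = s.
Proof. by rewrite /ev hornerX hornerC. Qed.
Lemma evXn k p s : ev 'X^k p s = s ^+ k.
Proof. by rewrite /ev hornerXn -rmorphXn hornerC. Qed.
Lemma ev0 p s : ev 0 p s = 0.
Proof. by rewrite /ev !horner0. Qed.
Lemma ev_sum (I : Type) (r : seq I) (P : pred I)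
    (F : I -> {poly {poly C}}) p s :
  ev (\sum_(i <- r | P i) F i) p s = \sum_(i <- r | P i) ev (F i) p s.
Proof. by rewrite /ev !horner_sum. Qed.
Definition evE := (evD, evN, evM, evC, evX, evXn, ev0, ev_sum).

Definition fibre F p : {poly C} := map_poly (horner_eval p) F.

Lemma fibreE F p s : (fibre F p).[s] = ev F p s.
Proof.
rewrite /ev -[in LHS](hornerC s p) -[(s%:P).[p]]/(horner_eval p s%:P).
by rewrite horner_map.
Qed.

Lemma fibre_monic F p : F \is monic -> fibre F p \is monic.
Proof. exact: monic_map. Qed.

Lemma size_fibre F p : F \is monic -> size (fibre F p) = size F.
Proof.
move=> mF; apply: size_map_poly_id0.
by rewrite (monicP mF) /= /horner_eval hornerC oner_neq0.
Qed.

(** Composition of F with a parametrised curve t |-> (P(t), S(t)). *)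
Definition pull F (P S : {poly C}) : {poly C} := (map_poly (comp_poly P) F).[S].

Lemma pullD F G P S : pull (F + G) P S = pull F P S + pull G P S.
Proof. by rewrite /pull rmorphD hornerD. Qed.
Lemma pullB F G P S : pull (F - G) P S = pull F P S - pull G P S.
Proof. by rewrite /pull rmorphB hornerD hornerN. Qed.
Lemma pullM F G P S : pull (F * G) P S = pull F P S * pull G P S.
Proof. by rewrite /pull rmorphM hornerM. Qed.
Lemma pullC (c : {poly C}) P S : pull c%:P P S = c \Po P.
Proof. by rewrite /pull map_polyC hornerC. Qed.
Lemma hornerXDC (p t : C) : ('X + p%:P).[t] = t + p.
Proof. by rewrite !hornerE. Qed.

Lemma dvdpX (a : {poly C}) : ('X %| a) = (a.[0] == 0).
Proof. by rewrite -[in LHS](subr0 'X) dvdp_XsubCl rootE. Qed.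

Lemma pull_sum (I : Type) (r : seq I) (A : pred I)
    (F : I -> {poly {poly C}}) P S :
  pull (\sum_(i <- r | A i) F i) P S = \sum_(i <- r | A i) pull (F i) P S.
Proof. by rewrite /pull rmorph_sum horner_sum. Qed.

Lemma horner_pull F P S t : (pull F P S).[t] = ev F P.[t] S.[t].
Proof.
elim/poly_ind: F => [|F c IH].
  by rewrite /pull rmorph0 horner0 horner0 ev0.
rewrite pullD pullM pullC !hornerE IH horner_comp !evE; congr (_ * _ + _).
by rewrite /pull map_polyX hornerX.
Qed.

Lemma taylor2 (A : comNzRingType) (Q : {poly A}) x h :
  exists r, Q.[x + h] = Q.[x] + Q^`().[x] * h + r * h ^+ 2.
Proof.
elim/poly_ind: Q => [|Q c [r IH]].
  by exists 0; rewrite deriv0 !horner0 !mul0r !addr0.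
exists (Q^`().[x] + r * (x + h)).
rewrite derivD derivM derivX derivC addr0 mulr1.
by rewrite !(hornerD, hornerM, hornerX, hornerC) IH; ring.
Qed.

(** Hensel's lemma, by Newton's iteration: as the derivative in s is nonzero at
    (p1, s1), adding a suitable multiple of 'X^K to an arc of order K makes it
    stay on the curve up to order K + 1. *)
Lemma hensel Q p1 s1 K : ev Q p1 s1 = 0 -> ev Q^`() p1 s1 != 0 ->
  exists S : {poly C}, S.[0] = s1 /\ 'X^K %| pull Q ('X + p1%:P) S.
Proof.
move=> Q0 Q'0; elim: K => [|K [S [S0 dS]]].
  by exists s1%:P; rewrite hornerC expr0 dvd1p.
have [K0|K0] := posnP K.
  exists s1%:P; rewrite K0 expr1 dvdpX hornerC; split=> //.
  by rewrite horner_pull hornerXDC add0r hornerC Q0.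
have /dvdpP[w wE] := dS.
pose c := - w.[0] / ev Q^`() p1 s1.
have [r rE] := taylor2 (map_poly (comp_poly ('X + p1%:P)) Q) S (c%:P * 'X^K).
exists (S + c%:P * 'X^K); split.
  by rewrite !hornerE S0 expr0n eqn0Ngt K0 mulr0 addr0.
rewrite /pull rE -/(pull Q _ S) wE deriv_map -/(pull Q^`() _ S).
have -> : w * 'X^K + pull Q^`() ('X + p1%:P) S * (c%:P * 'X^K)
   + r * (c%:P * 'X^K) ^+ 2
  = (w + pull Q^`() ('X + p1%:P) S * c%:P + r * c%:P ^+2 * 'X^K) * 'X^K by ring.
rewrite exprS dvdp_mul2r ?monic_neq0 ?monicXn// dvdpX.
rewrite !(hornerD, hornerM) horner_pull hornerXn hornerXDC add0r hornerC S0.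
by rewrite expr0n eqn0Ngt K0 mulr0 addr0 /c mulrC divfK// subrr.
Qed.

Variable U : set_system nat.
Context {UU : UltraFilter U}.
Hypothesis leU : eventually `<=` U.
Local Notation "u ~> l" := (ulim U u l) (at level 70).

Lemma ulim_horner (c : {poly C}) u a : u ~> a -> (fun j => c.[u j]) ~> c.[a].
Proof.
move=> ua; elim/poly_ind: c => [|c d IH].
  rewrite horner0; apply: ulim_near (ulim_cst 0).
  by near=> j; rewrite /= horner0.
rewrite !hornerE; apply: ulim_near (ulimD (ulimM IH ua) (ulim_cst d)).
by near=> j; rewrite /= !hornerE.
Unshelve. all: by end_near. Qed.

Lemma ulim_ev F u v a b : u ~> a -> v ~> b ->
  (fun j => ev F (u j) (v j)) ~> ev F a b.
Proof.
move=> ua vb; elim/poly_ind: F => [|F d IH].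
  rewrite ev0; apply: ulim_near (ulim_cst 0).
  by near=> j; rewrite /= ev0.
rewrite !evE.
apply: ulim_near (ulimD (ulimM IH vb) (ulim_horner d ua)).
by near=> j; rewrite /= !evE.
Unshelve. all: by end_near. Qed.

(** The difference quotient of F in s is a polynomial, hence converges to the
    derivative. *)
Lemma diff_quotient F u v w a b : u ~> a -> v ~> b -> w ~> b ->
  exists2 r, r ~> ev F^`() a b &
    forall j, ev F (u j) (v j) - ev F (u j) (w j) = (v j - w j) * r j.
Proof.
move=> ua vb wb; elim/poly_ind: F => [|F d [r rl rE]].
  exists (fun=> 0); first by rewrite deriv0 ev0; exact: ulim_cst.
  by move=> j; rewrite !ev0 mulr0 subr0.
exists (fun j => ev F (u j) (v j) + w j * r j).
  rewrite derivD derivM derivX derivC addr0 mulr1 !evE addrC [_ * b]mulrC.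
  by apply: ulimD => //; [exact: ulim_ev | exact: ulimM].
move=> j; rewrite !evE; rewrite mulrDr mulrCA -rE; ring.
Qed.

(** The product of the distances of s to the roots of the fibre polynomial over
    u j is |F (u j, s)|, which tends to 0; so the nearest root tends to s. *)
Lemma root_lsc F u a s : F \is monic -> (1 < size F)%N ->
  u ~> a -> ev F a s = 0 ->
  exists2 v, v ~> s & forall j, ev F (u j) (v j) = 0.
Proof.
move=> mF sF ua Fs.
have ex j : exists x, ev F (u j) x = 0 /\
    `|s - x| ^+ (size F).-2.+1 <= `|ev F (u j) s|.
  have [rs rsE] := closed_field_poly_normal (fibre F (u j)).
  rewrite (monicP (fibre_monic (u j) mF)) scale1r in rsE.
  have srs : size rs = (size F).-2.+1.
    have := size_fibre (u j) mF; rewrite rsE size_prod_XsubC => h.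
    by move: sF; rewrite -h => rs0; rewrite /= prednK.
  have evr x : ev F (u j) x = \prod_(z <- rs) (x - z).
    by rewrite -fibreE rsE horner_prod; apply: eq_bigr => z _; rewrite !hornerE.
  rewrite -{1}srs evr normr_prod.
  have [|x xrs hx] := seq_argmin (r := rs) (fun z => normr_real (s - z)).
    by rewrite srs.
  exists x; split.
    rewrite evr; apply/eqP; rewrite prodf_seq_eq0; apply/hasP; exists x => //=.
    by rewrite subrr.
  rewrite -iter_mulr_1 -(count_predT rs) -big_const_seq big_seq [leRHS]big_seq.
  by apply: ler_prod => z zrs; rewrite normr_ge0 hx.
have [v hv] := choice ex; exists v; last by move=> j; case: (hv j).
suff h : (fun j => s - v j) ~> 0.
  rewrite -[s]subr0; apply: ulim_near (ulimB (ulim_cst s) h).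
  by near=> j; rewrite /= opprB addrC subrK.
apply: (ulim0_root (k := (size F).-2)).
apply: (ulim0_le (v := fun j => ev F (u j) s)).
  by rewrite -Fs; apply: ulim_ev => //; exact: ulim_cst.
by near=> j; rewrite /= normrX; case: (hv j).
Unshelve. all: by end_near. Qed.

End PlanePoly.

(** * Counting and reflecting coefficients *)

Lemma kernel_ex (K : fieldType) (S T : finType) (a : S -> T -> K) :
  (#|T| < #|S|)%N -> exists c : S -> K, (exists x, c x != 0) /\
    forall t, \sum_x c x * a x t = 0.
Proof.
move=> TS; pose M := \matrix_(i < #|S|, j < #|T|) a (enum_val i) (enum_val j).
have : kermx M != 0.
  by rewrite kermx_eq0 /row_free neq_ltn (leq_ltn_trans (rank_leq_col M)).
move=> /rowV0Pn[v /sub_kermxP vM v0].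
exists (fun x => v 0 (enum_rank x)); split.
  have /rV0Pn[i vi] := v0; by exists (enum_val i); rewrite enum_valK.
move=> t; have := congr1 (fun A : 'rV_#|T| => A 0 (enum_rank t)) vM.
rewrite !mxE => E; rewrite -[RHS]E [RHS](reindex (@enum_rank S)) /=; last first.
  by apply: onW_bij; exact: enum_rank_bij.
by apply: eq_bigr => x _; rewrite mxE !enum_rankK.
Qed.

Lemma dvdp_Xn (K : fieldType) (p : {poly K}) k :
  (forall i, (i < k)%N -> p`_i = 0) -> 'X^k %| p.
Proof.
move=> pk; rewrite -(poly_take_drop k p); have -> : take_poly k p = 0.
  by apply/polyP => i; rewrite coef_take_poly coef0; case: ltnP => // /pk.
by rewrite add0r dvdp_mull.
Qed.

Section Reflect.
Variable R : realType.
Local Notation C := R[i].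
Implicit Types (p s z : C).

Lemma conj_real_Im z : z^* = z -> complex.Im z = 0.
Proof.
case: z => a b [] /esym/eqP.
by rewrite -addr_eq0 -mulr2n -mulr_natl mulf_eq0 pnatr_eq0 /= => /eqP.
Qed.

Lemma conj_circle p : `|p| = 1 -> p^* = p^-1.
Proof.
move=> p1; have p0 : p != 0 by rewrite -normr_gt0 p1.
by apply: (mulfI p0); rewrite -normCK p1 expr1n mulfV.
Qed.

(** The reciprocal polynomial p^e conj(d(1 / conj(p))). *)
Definition reflect_poly e (d : {poly C}) : {poly C} :=
  \poly_(i < e.+1) (d`_(e - i))^*.

Lemma horner_reflect e (d : {poly C}) p : (size d <= e.+1)%N -> `|p| = 1 ->
  (reflect_poly e d).[p] = p ^+ e * (d.[p])^*.
Proof.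
move=> de p1; have p0 : p != 0 by rewrite -normr_gt0 p1.
rewrite (horner_coef_wide _ de) horner_poly rmorph_sum mulr_sumr.
rewrite (reindex_inj rev_ord_inj) /=; apply: eq_bigr => i _.
have ie : (i <= e)%N by rewrite -ltnS.
have -> : (d`_i * p ^+ i)^* = (d`_i)^* * p ^- i.
  by rewrite rmorphM rmorphXn /= (conj_circle p1) exprVn.
by rewrite subSS subKn// mulrCA -expfB_cond// (negPf p0) add0n.
Qed.

End Reflect.

(** * Prime ideals of K[p][s] *)

Section PrimeIdeal.
Variable K : closedFieldType.
Implicit Types F G Q : {poly {poly K}}.

Lemma fibre_eq0_dvd F (a : K) : map_poly (horner_eval a) F = 0 ->
  exists2 F', F = ('X - a%:P)%:P * F' & size F' = size F.
Proof.
move=> F0; pose F' := map_poly (fun c => c %/ ('X - a%:P)) F.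
have FE : F = ('X - a%:P)%:P * F'.
  apply/polyP => i; rewrite coefCM coef_map_id0 ?div0p//.
  rewrite mulrC divpK// dvdp_XsubCl rootE.
  by rewrite -[(F`_i).[a]]/(horner_eval a F`_i) -coef_map F0 coef0.
exists F' => //; rewrite [in RHS]FE mul_polyC size_scale//.
by rewrite polyXsubC_eq0.
Qed.

Variable J : {poly {poly K}} -> Prop.
Hypothesis J_sub : forall F G, J F -> J G -> J (F - G).
Hypothesis J_mul : forall F G, J F -> J (G * F).
Hypothesis J_prime : forall F G, J (F * G) -> J F \/ J G.
Hypothesis J_polyC : forall d : {poly K}, J d%:P -> d = 0.
Variable chi : {poly {poly K}}.
Hypothesis chi_monic : chi \is monic.
Hypothesis J_chi : J chi.

(** Gauss's argument: for each root a of d, 'X - a divides F or u and can be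
    cancelled, until d is constant. The leading coefficient of F then divides
    a constant, so it is invertible. *)
Lemma min_monic_of_mul n (d : {poly K}) F u : d != 0 -> d%:P * chi = F * u ->
  J F -> size F = n -> exists Q, [/\ Q \is monic, J Q & size Q = n].
Proof.
have [k] := ubnP (size d); elim: k => // k IH in d F u *.
rewrite ltnS => dk d0 E vF sF.
have u0 : u != 0.
  apply: contra_eq_neq E => ->; rewrite mulr0 mulf_neq0// ?polyC_eq0//.
  exact: monic_neq0.
have F0 : F != 0.
  apply: contra_eq_neq E => ->; rewrite mul0r mulf_neq0// ?polyC_eq0//.
  exact: monic_neq0.
have [d1|d1] := leqP (size d) 1.
  have dc : size d = 1%N by apply/eqP; rewrite eqn_leq d1 lt0n size_poly_eq0.
  have ldu : lead_coef F * lead_coef u = d.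
    by rewrite -lead_coefM -E lead_coefM lead_coefC (monicP chi_monic) mulr1.
  have lF : size (lead_coef F) = 1%N.
    have := congr1 (fun x : {poly K} => size x) ldu.
    rewrite dc => /eqP; rewrite size_mul_eq1 => /andP[/eqP->] //.
  have [c c0 lc] := size_poly1P _ (introT eqP lF).
  exists (c^-1%:P *: F); split.
  - by rewrite monicE lead_coefZ lc -polyCM mulVf.
  - by rewrite -mul_polyC; apply: J_mul.
  - by rewrite size_scale// polyC_eq0 invr_eq0.
have [a] : exists a, root d a by apply/closed_rootP; rewrite neq_ltn d1 orbT.
move=> /factor_theorem[d' dE].
have Xa0 : ('X - a%:P)%:P != 0 :> {poly {poly K}}.
  by rewrite polyC_eq0 polyXsubC_eq0.
have d'0 : d' != 0 by apply: contra_neq d0 => d'0; rewrite dE d'0 mul0r.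
have d'k : (size d' < k)%N.
  by move: dk; rewrite dE size_Mmonic ?monicXsubC// size_XsubC addn2.
have : map_poly (horner_eval a) F * map_poly (horner_eval a) u = 0.
  rewrite -rmorphM -E rmorphM/= map_polyC /= /horner_eval dE.
  by rewrite hornerM hornerXsubC subrr mulr0 mul0r.
move=> /eqP; rewrite mulf_eq0 => /orP[]/eqP/fibre_eq0_dvd[F' FE sF'].
- apply: (IH d' F' u) => //.
  + apply: (mulfI Xa0).
    by rewrite mulrA -polyCM [_ * d']mulrC -dE E FE mulrA.
  + have /J_prime[|//] : J (('X - a%:P)%:P * F') by rewrite -FE.
    by move=> /J_polyC/eqP; rewrite polyXsubC_eq0.
  + by rewrite sF'.
- apply: (IH d' F F') => //; apply: (mulfI Xa0).
  by rewrite mulrA -polyCM [_ * d']mulrC -dE E FE mulrCA.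
Qed.

(** This q is the minimal polynomial of s over K(p), as a point of the curve
    defined by J; it has polynomial coefficients because s is integral over
    K[p], being a root of the monic chi. *)
Lemma prime_ideal_min : exists q, [/\ q \is monic, J q &
  forall F, J F -> (size F < size q)%N -> F = 0].
Proof.
have exn : exists n, `[< exists F, [/\ F != 0, J F & size F = n] >].
  exists (size chi); apply/asboolP; exists chi; split=> //.
  exact: monic_neq0.
have [n /asboolP[F [F0 vF sF]] nmin] := ex_minnP exn.
have small G : J G -> (size G < n)%N -> G = 0.
  move=> vG; apply: contraTeq => G0; rewrite -leqNgt; apply: nmin.
  by apply/asboolP; exists G.
have := Pdiv.Idomain.divp_eq chi F; set lk := (lead_coef F ^+ _).
set Q := chi %/ F; set r := chi %% F => E.
have r0 : r = 0.
  apply: small; last by rewrite -sF /r ltn_modp.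
  have -> : r = lk%:P * chi - Q * F by rewrite mul_polyC E addrAC subrr add0r.
  by apply: J_sub; apply: J_mul.
have lk0 : lk != 0 by rewrite expf_neq0// lead_coef_eq0.
have [q [mq vq sq]] : exists Q, [/\ Q \is monic, J Q & size Q = n].
  apply: (min_monic_of_mul (d := lk) (F := F) (u := Q)) => //.
  by rewrite mul_polyC E r0 addr0 mulrC.
by exists q; rewrite sq.
Qed.

Variable q : {poly {poly K}}.
Hypothesis q_monic : q \is monic.
Hypothesis J_q : J q.
Hypothesis q_min : forall F, J F -> (size F < size q)%N -> F = 0.

Lemma prime_ideal_size : (1 < size q)%N.
Proof.
rewrite ltnNge; apply/negP => /size1_polyC qE.
have : q`_0 = 0 by apply: J_polyC; rewrite -qE.
by move=> q0; move: (monic_neq0 q_monic); rewrite qE q0 polyC0 eqxx.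
Qed.

Lemma prime_ideal_dvd F : J F -> exists G, F = G * q.
Proof.
move=> vF; have E := Pdiv.RingMonic.rdivp_eq q_monic F.
exists (Pdiv.Ring.rdivp F q).
suff r0 : Pdiv.Ring.rmodp F q = 0 by rewrite {1}E r0 addr0.
apply: q_min; last by rewrite Pdiv.Ring.ltn_rmodp monic_neq0.
have -> : Pdiv.Ring.rmodp F q = F - Pdiv.Ring.rdivp F q * q.
  by rewrite {2}E addrAC subrr add0r.
by apply: J_sub => //; apply: J_mul.
Qed.

(** A nontrivial common factor of q and F would give, J being prime, a factor
    of q in J of smaller degree; so the resultant of q and F is nonzero. *)
Lemma prime_ideal_bezout F : F != 0 -> (size F < size q)%N ->
  exists (u v : {poly {poly K}}) (d : {poly K}), d != 0 /\ u * q + v * F = d%:P.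
Proof.
move=> F0 sF; have [sF1|sF1] := leqP (size F) 1.
  have FE := size1_polyC sF1.
  exists 0, 1, F`_0; split; last by rewrite mul0r mul1r add0r -FE.
  by apply: contra_neq F0 => F00; rewrite FE F00.
have [[u v] /= [_ _ E]] := resultant_in_ideal prime_ideal_size sF1.
exists u, v, (resultant q F); split=> //.
rewrite resultant_eq0 -leqNgt; set g := gcdp q F.
have := Pdiv.Idomain.dvdp_gcdl q F.
have gF : (size g <= size F)%N.
  by apply: Pdiv.Idomain.dvdp_leq (Pdiv.Idomain.dvdp_gcdr _ _).
move=> /Pdiv.Idomain.dvdpP[[c w] /= c0 cE].
rewrite leqNgt; apply/negP => sg.
have q0 := monic_neq0 q_monic.
have w0 : w != 0.
  apply: contraTneq c0 => w0; move/eqP: cE; rewrite w0 mul0r scale_poly_eq0.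
  by rewrite (negPf q0) orbF => ->.
have sw : (size w < size q)%N.
  have g0 : g != 0 by rewrite -size_poly_gt0 ltnW.
  have := congr1 (fun x : {poly {poly K}} => size x) cE.
  rewrite size_scale// size_mul// => ->.
  rewrite -[X in (_ < X.-1)%N]prednK ?addn_gt0 ?size_poly_gt0 ?w0//= -subn1.
  by rewrite ltn_subRL addnC ltn_add2l.
have /J_prime[vw|vg] : J (w * g) by rewrite -cE -mul_polyC; apply: J_mul.
  by move: w0; rewrite (q_min vw sw) eqxx.
by move: sg; rewrite (q_min vg) ?size_poly0//; apply: leq_ltn_trans sF.
Qed.

End PrimeIdeal.
(** * Real plane curves over the disc *)

Section PlaneCurve.
Variable R : realType.
Local Notation C := R[i].
Implicit Types (F G Q : {poly {poly C}}) (p s : C).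

Variable U : set_system nat.
Context {UU : UltraFilter U}.
Hypothesis leU : eventually `<=` U.
Local Notation "u ~> l" := (ulim U u l) (at level 70).

Lemma ulim_shift p z : (fun j => p + z / j.+1%:R) ~> p.
Proof.
rewrite -[X in _ ~> X]addr0 -[X in _ + X](mulr0 z).
by apply: ulimD; [|apply: ulimM]; try exact: ulim_cst; exact: ulim_inv_nat.
Qed.

Lemma near_nonroot (d : {poly C}) p z : z != 0 -> d != 0 ->
  U [set j | d.[p + z / j.+1%:R] != 0].
Proof.
move=> z0 d0; have [m [e]] := multiplicity_XsubC d p; rewrite d0 /= => ep dE.
have h : (fun j => e.[p + z / j.+1%:R]) ~> e.[p].
  exact: ulim_horner (ulim_shift p z).
apply: filterS (ulim_neq0 ep h) => j /= hj.
rewrite dE hornerM mulf_neq0//.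
  by rewrite -normr_gt0 (le_lt_trans _ hj)// divr_ge0.
rewrite horner_exp hornerXsubC expf_neq0// addrAC subrr add0r.
by rewrite mulf_neq0// invr_neq0// pnatr_eq0.
Qed.

(** The function g may be unbounded here; that it is bounded on W will follow
    from the convergence of its values along this sequence. *)
Lemma maximizing_seq (T : Type) (A : set T) (g : T -> R) : A !=set0 ->
  exists2 y : nat -> T, (forall j, A (y j)) &
    forall x e, A x -> 0 < e -> U [set j | g x - e < g (y j)].
Proof.
move=> [x0 Ax0]; have [ubA|nubA] := pselect (has_ubound (g @` A)).
  have sA : has_sup (g @` A) by split=> //; exists (g x0), x0.
  have /choice[y yP] : forall j : nat, exists x, A x /\
      sup (g @` A) - j.+1%:R^-1 < g x.
    move=> j; have j0 : 0 < j.+1%:R^-1 :> R by rewrite invr_gt0.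
    by have [_ [x Ax <-] h] := sup_adherent j0 sA; exists x.
  exists y => [j|x e Ax e0]; first by case: (yP j).
  have ec0 : 0 < e%:C%C :> C by rewrite ltcR.
  apply: filterS (ulim_inv_nat (R := R) leU ec0) => j /=.
  rewrite subr0 -(rmorph_nat (real_complex R)) -fmorphV cReal_norm ltcR.
  rewrite ger0_norm ?invr_ge0// => je; apply: le_lt_trans (yP j).2.
  have xs : g x <= sup (g @` A) by apply: ub_le_sup => //; exists x.
  exact: lerB xs (ltW je).
have /choice[y yP] : forall j : nat, exists x, A x /\ j%:R < g x.
  move=> j; apply/not_existsP => h; apply: nubA; exists j%:R => _ [x Ax <-].
  by rewrite leNgt; apply/negP => jx; apply: (h x).
exists y => [j|x e Ax e0]; first by case: (yP j).
apply: leU; exists (Num.bound `|g x|) => // j /= xj.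
apply: lt_trans (yP j).2; rewrite ltrBlDr.
have gx : g x < (Num.bound `|g x|)%:R.
  exact: le_lt_trans (ler_norm _) (archi_boundP (normr_ge0 _)).
by rewrite ltr_wpDr ?ltW// (lt_le_trans gx)// ler_nat.
Qed.

(** The set W stands for the image of Lambda. By [W_closed] and [W_open] it is a
    union of sheets over the open disc, and [chi_circle] says that it lies on a
    curve which over the unit circle consists of fixed points of the reflection
    (p, s) |-> (1 / conj(p), conj(s) / conj(p)). *)
Variable W : set (C * C).
Hypothesis W_disc : forall p s, W (p, s) -> `|p| < 1.
Hypothesis W_bounded : exists M : C, forall p s, W (p, s) -> `|s| <= M.
Hypothesis W_closed : forall u v p s, (forall j, W (u j, v j)) ->
  u ~> p -> v ~> s -> `|p| < 1 -> W (p, s).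
Hypothesis W_open : forall u p s, W (p, s) -> u ~> p ->
  exists2 v, v ~> s & U [set j | W (u j, v j)].
Hypothesis W0 : W !=set0.

Definition van F := forall p s, W (p, s) -> ev F p s = 0.

Hypothesis W_prime : forall F G, van (F * G) -> van F \/ van G.
Variable chi : {poly {poly C}}.
Hypothesis chi_monic : chi \is monic.
Hypothesis chi_van : van chi.
Hypothesis chi_circle : forall p s, `|p| = 1 -> ev chi p s = 0 -> s = p * s^*.

Lemma W_nonroot (d : {poly C}) : d != 0 -> exists p s, W (p, s) /\ d.[p] != 0.
Proof.
move=> d0; have [[p s] Wps] := W0.
have [v _ Uv] := W_open Wps (ulim_shift p 1).
have [j /= Wj dj] := ultra_and Uv (near_nonroot p (oner_neq0 _) d0).
by exists (p + 1 / j.+1%:R), (v j).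
Qed.

Lemma W_closed_near u v p s : U [set j | W (u j, v j)] ->
  u ~> p -> v ~> s -> `|p| < 1 -> W (p, s).
Proof.
move=> Wuv up vs p1; have [[p0 s0] W00] := W0.
pose w j := if pselect (W (u j, v j)) is left _ then (u j, v j) else (p0, s0).
have Ww j : W (w j) by rewrite /w; case: pselect.
apply: (@W_closed (fun j => (w j).1) (fun j => (w j).2)) => //.
- by move=> j; rewrite -surjective_pairing.
- by apply: ulim_near up; apply: filterS Wuv => j /=; rewrite /w; case: pselect.
- by apply: ulim_near vs; apply: filterS Wuv => j /=; rewrite /w; case: pselect.
Qed.

Lemma W_circle u v p s : (forall j, W (u j, v j)) ->
  u ~> p -> v ~> s -> `|p| = 1 -> s = p * s^*.
Proof.
move=> Wuv up vs p1; apply: chi_circle => //.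
apply: (ulim_uniq (ulim_ev chi up vs)); apply: ulim_near (ulim_cst 0).
by apply: filterE => j /=; rewrite (chi_van (Wuv j)).
Qed.

Lemma van_polyC (d : {poly C}) : van d%:P -> d = 0.
Proof.
move=> vd; apply/eqP/negPn/negP => /W_nonroot[p [s [/vd]]].
by rewrite evC => ->; rewrite eqxx.
Qed.

Lemma vanB F G : van F -> van G -> van (F - G).
Proof. by move=> vF vG p s w; rewrite evB vF// vG// subr0. Qed.

Lemma vanMl F G : van F -> van (G * F).
Proof. by move=> vF p s w; rewrite evM vF// mulr0. Qed.

Section MinimalPolynomial.
Variable q : {poly {poly C}}.
Hypothesis q_monic : q \is monic.
Hypothesis q_van : van q.
Hypothesis q_min : forall F, van F -> (size F < size q)%N -> F = 0.

Lemma size_q : (1 < size q)%N.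
Proof. exact: prime_ideal_size van_polyC q q_monic q_van. Qed.

Lemma van_dvd F : van F -> exists G, F = G * q.
Proof. exact: prime_ideal_dvd vanB vanMl q q_monic q_van q_min F. Qed.

Lemma bezout_q F : F != 0 -> (size F < size q)%N ->
  exists (u v : {poly {poly C}}) (d : {poly C}), d != 0 /\ u * q + v * F = d%:P.
Proof.
exact: prime_ideal_bezout vanMl W_prime van_polyC q q_monic q_van q_min F.
Qed.

(** The polynomial q is coprime to its derivative, which has a smaller degree.
    A factor 'X is added to d: a quotient whose numerator vanishes where d does
    is then 0 over p = 0, and can only be constant if it is 0. *)
Lemma discriminant : exists d : {poly C}, [/\ d != 0, d.[0] = 0 &
  forall p s, ev q p s = 0 -> d.[p] != 0 -> ev q^`() p s != 0].
Proof.
have sq' : (size q^`() < size q)%N by rewrite lt_size_deriv// monic_neq0.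
have q'0 : q^`() != 0.
  apply/eqP => /(congr1 (fun F : {poly {poly C}} => F`_(size q).-2)).
  rewrite coef_deriv coef0 prednK; last by rewrite -subn1 subn_gt0 size_q.
  rewrite -lead_coefE (monicP q_monic) => /eqP.
  rewrite -polyC_natr polyC_eq0 pnatr_eq0.
  by move: size_q; case: (size q) => [|[]].
have [u [v [d [d0 E]]]] := bezout_q q'0 sq'.
exists (d * 'X); split.
- by rewrite mulf_neq0// polyX_eq0.
- by rewrite !hornerE.
move=> p s qps; rewrite hornerM mulf_eq0 negb_or => /andP[dp _].
apply: contra_neq dp => q'ps.
by rewrite -(evC d p s) -E !evE qps q'ps !mulr0 addr0.
Qed.

(** A sequence of points of the curve converging to a simple point follows the
    polynomial arc through it, up to an error of order K, on which every
    polynomial can thus be evaluated. *)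
Lemma ev_arc F S K u v p s : ev q^`() p s != 0 -> S.[0] = s ->
  'X^K %| pull q ('X + p%:P) S -> u ~> p -> v ~> s ->
  U [set j | ev q (u j) (v j) = 0] ->
  exists b l, b ~> l /\
    U [set j | ev F (u j) (v j) =
      (pull F ('X + p%:P) S).[u j - p] + (u j - p) ^+ K * b j].
Proof.
move=> q's S0 /dvdpP[w wE] up vs qv.
have t0 : (fun j => u j - p) ~> 0 by exact: ulim_sub0.
have ws : (fun j => S.[u j - p]) ~> s by rewrite -S0; exact: ulim_horner.
have [r rl rE] := diff_quotient q up vs ws.
have [r' r'l r'E] := diff_quotient F up vs ws.
exists (fun j => - w.[u j - p] / r j * r' j),
  (- w.[0] / ev q^`() p s * ev F^`() p s).
split.
  apply: ulimM r'l; apply: ulimM; last exact: ulimV.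
  by apply: ulimN; exact: ulim_horner.
apply: filterS2 qv (ulim_neq0 q's rl) => j /= qvj rj.
have {}rj : r j != 0 by rewrite -normr_gt0 (le_lt_trans _ rj)// divr_ge0.
have pullE H : (pull H ('X + p%:P) S).[u j - p] = ev H (u j) S.[u j - p].
  by rewrite horner_pull hornerXDC subrK.
rewrite pullE -[LHS](subrK (ev F (u j) S.[u j - p])) r'E addrC; congr (_ + _).
have : v j - S.[u j - p] = - (w.[u j - p] * (u j - p) ^+ K) / r j.
  rewrite -hornerXn -hornerM -wE pullE; apply: (canRL (mulfK rj)).
  by rewrite -rE qvj sub0r.
by move=> ->; field.
Qed.

Section MaxPrinciple.
Variable d : {poly C}.
Hypothesis d0 : d != 0.
Hypothesis d_disc : forall p s, ev q p s = 0 -> d.[p] != 0 -> ev q^`() p s != 0.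

(** The open mapping property of a non-constant rational function G / D on the
    curve: near a simple point its values go in every direction, in particular
    in that of +i. *)
Lemma Im_increase G (D : {poly C}) p s : W (p, s) -> d.[p] != 0 ->
  D.[p] != 0 -> (size G < size q)%N ->
  G != (ev G p s / D.[p] *: D)%:P ->
  exists p' s', W (p', s') /\
    complex.Im (ev G p s / D.[p]) < complex.Im (ev G p' s' / D.[p']).
Proof.
set c := _ / _ => Wps dp Dp sG Gc.
pose E := G - (c *: D)%:P.
have E0 : E != 0 by rewrite subr_eq0.
have sE : (size E < size q)%N.
  rewrite (leq_ltn_trans (size_polyD _ _))// gtn_max sG size_polyN.
  by rewrite (leq_ltn_trans (size_polyC_leq1 _))// size_q.
have [a [b [e [e0 eE]]]] := bezout_q E0 sE.
have qps := q_van Wps; have q'ps := d_disc qps dp.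
(* An arc of order K = size e on q = 0 cannot lie on E = 0 up to the same
   order, for a q + b E = e(p). *)
pose K := size e.
have [S [S0 dS]] := hensel K qps q'ps.
pose H := pull E ('X + p%:P) S.
have HK : ~~ ('X^K %| H).
  apply/negP => dH; have : 'X^K %| e \Po ('X + p%:P).
    have -> : e \Po ('X + p%:P) = pull a ('X + p%:P) S * pull q ('X + p%:P) S
        + pull b ('X + p%:P) S * H.
      by rewrite -(pullC e _ S) -eE pullD pullM pullM.
    by apply: dvdp_add; apply: dvdp_mull.
  have se : size (e \Po ('X + p%:P)) = K.
    by rewrite size_comp_poly2// size_XaddC.
  have e'0 : e \Po ('X + p%:P) != 0 by rewrite -size_poly_gt0 se size_poly_gt0.
  by move=> /(dvdp_leq e'0); rewrite size_polyXn se ltnn.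
have H0 : H != 0 by apply: contraNneq HK => ->; rewrite dvdp0.
have [m [H1]] := multiplicity_XsubC H 0.
rewrite H0 /= => H10; rewrite subr0 => HE.
have mK : (m < K)%N.
  rewrite ltnNge; apply: contra HK => Km.
  by rewrite HE; apply: dvdp_mull; exact: dvdp_exp2l.
have Eps : ev E p s = 0.
  by rewrite !evE hornerZ divfK// subrr.
have m0 : (0 < m)%N.
  rewrite lt0n; apply: contra H10 => /eqP m0.
  rewrite rootE -[H1]mulr1 -(expr0 'X) -m0 -HE.
  by rewrite horner_pull hornerXDC add0r S0 Eps.
pose beta := H1.[0] / D.[p].
have beta0 : beta != 0 by rewrite mulf_neq0// invr_neq0.
(* The direction in which z ^ m * beta is a positive multiple of i. *)
pose z := m.-root ('i%C * beta^* ).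
have up := ulim_shift p z.
have [v vs Wv] := W_open Wps up.
set u := (fun j => _) in up Wv.
have qv : U [set j | ev q (u j) (v j) = 0] by apply: filterS Wv => j /q_van.
have [r [l [rl rE]]] := ev_arc E q'ps S0 dS up vs qv.
have Du : (fun j => D.[u j]) ~> D.[p] by exact: ulim_horner.
have t0 : (fun j => u j - p) ~> 0 by exact: ulim_sub0.
pose y j := z ^+ m * ((H1.[u j - p] + (u j - p) ^+ (K - m) * r j) / D.[u j]).
have yl : y ~> z ^+ m * ((H1.[0] + 0 ^+ (K - m) * l) / D.[p]).
  apply: ulimM; first exact: ulim_cst.
  apply: ulimM; last exact: ulimV.
  apply: ulimD; first exact: ulim_horner.
  by apply: ulimM => //; exact: ulimX.
have yIm : 0 < complex.Im (z ^+ m * ((H1.[0] + 0 ^+ (K - m) * l) / D.[p])).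
  rewrite expr0n subn_eq0 leqNgt mK mul0r addr0 -/beta rootCK// -mulrA.
  rewrite [beta^* * _]mulrC -normCK.
  have [x -> x0] : exists2 x : R, `|beta| ^+ 2 = x%:C%C & 0 < x.
    by apply: gt0_cReal; rewrite exprn_gt0// normr_gt0.
  by rewrite /= mul0r mul1r add0r.
have [j [/= yj [rj [/= Wj Dj]]]] : exists j,
    0 < complex.Im (y j) /\ ev E (u j) (v j) =
      (pull E ('X + p%:P) S).[u j - p] + (u j - p) ^+ K * r j /\
    W (u j, v j) /\ D.[u j] != 0.
  have [j [[h1 h2] [h3 h4]]] := ultra_ex (filterI
    (filterI (ulim_Im_gt yl yIm) rE) (filterI Wv (ulim_neq0 Dp Du))).
  exists j; split=> //; split=> //; split=> //.
  by rewrite -normr_gt0 (le_lt_trans _ h4)// divr_ge0.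
exists (u j), (v j); split=> //.
rewrite -subr_gt0 -raddfB /=.
have -> : ev G (u j) (v j) / D.[u j] - c = (j.+1%:R ^- m) * y j.
  have -> : ev G (u j) (v j) = ev E (u j) (v j) + c * D.[u j].
    by rewrite !evE hornerZ subrK.
  rewrite rj -/H HE mulrDl mulfK// addrK hornerM hornerXn /y.
  have -> : u j - p = z / j.+1%:R by rewrite /u addrAC subrr add0r.
  rewrite -[in (z / _) ^+ K](subnK (ltnW mK)) exprD.
  rewrite !expr_div_n.
  have jn : j.+1%:R != 0 :> C by rewrite pnatr_eq0.
  by field; rewrite Dj !expf_neq0.
have -> : j.+1%:R ^- m = (j.+1%:R ^- m)%:C%C :> C.
  by rewrite fmorphV rmorphXn rmorph_nat.
case: (y j) yj => a' b' /= yj; rewrite mul0r addr0.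
by rewrite mulr_gt0// invr_gt0 exprn_gt0.
Qed.

Variables (p0 : C) (k : nat) (D0 : {poly C}).
Hypothesis p0_disc : `|p0| < 1.
Hypothesis k_gt0 : (0 < k)%N.
Hypothesis D0_disc : forall p, `|p| <= 1 -> D0.[p] != 0.
Hypothesis dp0 : d.[p0] != 0.
Hypothesis d_0 : d.[0] = 0.
Let D := ('X - p0%:P) ^+ k * D0.

(** The pole of 1 / D at p0 is compensated when G vanishes to a higher order
    along every branch of W over p0. *)
Definition flat_at G := forall s, W (p0, s) -> exists S,
  [/\ S.[0] = s, 'X^(k.+1) %| pull q ('X + p0%:P) S
    & 'X^(k.+1) %| pull G ('X + p0%:P) S].

Lemma ulim_quotient G u v p s : flat_at G -> (forall j, W (u j, v j)) ->
  u ~> p -> v ~> s ->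
  (fun j => ev G (u j) (v j) / D.[u j]) ~> ev G p s / D.[p].
Proof.
move=> flG Wuv up vs.
have p1 : `|p| <= 1.
  apply: (ulim_le _ up) => //; apply: filterE => j.
  by rewrite /= ltW// (W_disc (Wuv j)).
have D0p := D0_disc p1.
have [pp0|pp0] := eqVneq p p0; last first.
  apply: ulimM; first exact: ulim_ev.
  apply: ulimV; last exact: ulim_horner.
  by rewrite hornerM horner_exp hornerXsubC mulf_neq0// expf_neq0// subr_eq0.
rewrite {}pp0 in up D0p p1 *.
have Wps : W (p0, s) by apply: W_closed_near up vs p0_disc; apply: filterE.
have [S [S0 dS /dvdpP[w wE]]] := flG s Wps.
have qv : U [set j | ev q (u j) (v j) = 0] by apply: filterE => j; exact: q_van.
have q's := d_disc (q_van Wps) dp0.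
have [b [l [bl bE]]] := ev_arc G q's S0 dS up vs qv.
have t0 : (fun j => u j - p0) ~> 0 by exact: ulim_sub0.
have -> : ev G p0 s / D.[p0] = 0 * ((w.[0] + l) / D0.[p0]).
  rewrite mul0r hornerM horner_exp hornerXsubC subrr expr0n.
  by rewrite eqn0Ngt k_gt0 mul0r invr0 mulr0.
have h : (fun j => (u j - p0) * ((w.[u j - p0] + b j) / D0.[u j])) ~>
    0 * ((w.[0] + l) / D0.[p0]).
  apply: ulimM => //; apply: ulimM.
    by apply: ulimD => //; exact: ulim_horner.
  by apply: ulimV => //; exact: ulim_horner.
apply: ulim_near h; apply: filterS bE => j /= ->.
rewrite wE hornerM hornerXn [D.[_]]hornerM horner_exp hornerXsubC.
have [->|tj] := eqVneq (u j - p0) 0.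
  by rewrite !exprS !mul0r mulr0 addr0 mul0r.
have D0j : D0.[u j] != 0 by apply: D0_disc; rewrite ltW// (W_disc (Wuv j)).
by rewrite exprS; field; rewrite D0j expf_neq0.
Qed.

Definition circle_real G := forall p s, `|p| = 1 -> s = p * s^* ->
  complex.Im (ev G p s / D.[p]) = 0.

Lemma D_neq0 p : `|p| <= 1 -> p != p0 -> D.[p] != 0.
Proof.
move=> p1 pp0; rewrite hornerM horner_exp hornerXsubC mulf_neq0 ?D0_disc//.
by rewrite expf_neq0// subr_eq0.
Qed.

Lemma neq_constD G c : (forall p s, d.[p] = 0 -> ev G p s = 0) -> c != 0 ->
  G != (c *: D)%:P.
Proof.
move=> Gd; apply: contra_neq => GE; apply/eqP.
have := Gd 0 0 d_0; rewrite GE evC hornerZ => /eqP; rewrite mulf_eq0.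
rewrite (negPf (D_neq0 _ _)) ?orbF ?normr0//.
by apply: contraTneq dp0 => <-; rewrite d_0 eqxx.
Qed.

(** The maximum principle for Im (G / D) on the closure of W. A positive maximum
    is not attained where d = 0, as G is 0 there, nor at p0, where G / D tends
    to 0, nor over the unit circle, where G / D is real; elsewhere
    [Im_increase] applies. *)
Lemma Im_le0 G : (size G < size q)%N ->
  (forall p s, d.[p] = 0 -> ev G p s = 0) -> circle_real G -> flat_at G ->
  forall p s, W (p, s) -> complex.Im (ev G p s / D.[p]) <= 0.
Proof.
move=> sG Gd Gr flG p1 s1 W1; rewrite leNgt; apply/negP => Im1.
pose g (x : C * C) := complex.Im (ev G x.1 x.2 / D.[x.1]).
have [y Wy ymax] := maximizing_seq g W0.
have Wuv j : W ((y j).1, (y j).2) by rewrite -surjective_pairing.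
have [p up] : exists p, (fun j => (y j).1) ~> p.
  by apply: (@ulim_ex _ _ _ _ 1) => j; rewrite ltW// (W_disc (Wuv j)).
have [M WM] := W_bounded.
have [s vs] : exists s, (fun j => (y j).2) ~> s.
  by apply: (@ulim_ex _ _ _ _ M) => j; exact: WM (Wuv j).
have fl := ulim_quotient flG Wuv up vs.
set c := _ / _ in fl.
have gc x : W x -> g x <= complex.Im c.
  move=> Wx; rewrite leNgt; apply/negP => cx.
  have e0 : 0 < (g x - complex.Im c) / 2 by rewrite divr_gt0// subr_gt0.
  have h1 : complex.Im (- c) > - (g x - (g x - complex.Im c) / 2).
    by rewrite raddfN /= ltrN2; lra.
  have [j /= h2 h3] := ultra_and (ymax _ _ Wx e0) (ulim_Im_gt (ulimN fl) h1).
  by move: h3; rewrite raddfN /= ltrN2 => /(lt_trans h2); rewrite ltxx.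
have Imc : 0 < complex.Im c by apply: lt_le_trans Im1 (gc _ W1).
have c0 : c != 0 by apply: contraTneq Imc => ->; rewrite ltxx.
have p1' : `|p| <= 1.
  apply: (ulim_le _ up) => //; apply: filterE => j.
  by rewrite /= ltW// (W_disc (Wuv j)).
have Dp : D.[p] != 0 by apply: contraNneq c0 => Dp; rewrite /c Dp invr0 mulr0.
have dp : d.[p] != 0 by apply: contraNneq c0 => dp; rewrite /c Gd// mul0r.
have Wps : W (p, s).
  apply: (W_closed_near _ up vs); first exact: filterE.
  rewrite lt_neqAle p1' andbT; apply: contraTneq Imc => np1.
  by rewrite Gr ?ltxx//; apply: (W_circle Wuv up vs).
have [p' [s' [W' lt']]] := Im_increase Wps dp Dp sG (neq_constD Gd c0).
by move: lt'; rewrite ltNge (gc _ W').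
Qed.

Lemma real_quotient_eq0 G : (size G < size q)%N ->
  (forall p s, d.[p] = 0 -> ev G p s = 0) -> circle_real G -> flat_at G ->
  G = 0.
Proof.
move=> sG Gd Gr flG; apply/eqP/negPn/negP => G0.
have Im0 p s : W (p, s) -> complex.Im (ev G p s / D.[p]) = 0.
  move=> Wps; apply/eqP; rewrite eq_le Im_le0//=.
  rewrite -oppr_le0 -raddfN /= -mulNr -evN; apply: Im_le0 => //.
  - by rewrite size_polyN.
  - by move=> p' s' /Gd; rewrite evN => ->; rewrite oppr0.
  - by move=> p' s' h1 h2; rewrite evN mulNr raddfN /= Gr ?oppr0.
  - move=> s' /flG[S [S0 dS GS]]; exists S; split; [exact: S0|exact: dS|].
    by rewrite -[- G]sub0r pullB /pull rmorph0 horner0 sub0r dvdpNr.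
have nz : d * ('X - p0%:P) != 0 by rewrite mulf_neq0// polyXsubC_eq0.
have [p [s [Wps]]] := W_nonroot nz.
rewrite hornerM hornerXsubC mulf_eq0 negb_or subr_eq0 => /andP[dp pp0].
have Dp : D.[p] != 0 by apply: D_neq0 => //; rewrite ltW// (W_disc Wps).
have Gc : G != (ev G p s / D.[p] *: D)%:P.
  have [->|] := eqVneq (ev G p s / D.[p]) 0; last exact: neq_constD.
  by rewrite scale0r.
have [p' [s' [W' ]]] := Im_increase Wps dp Dp sG Gc.
by rewrite !Im0// ltxx.
Qed.

End MaxPrinciple.

Definition bimon i j : {poly {poly C}} := ('X^i)%:P * 'X^j.

Lemma ev_bimon (c : C) i j p s :
  ev (c%:P%:P * bimon i j) p s = c * (p ^+ i * s ^+ j).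
Proof. by rewrite /bimon !evE hornerC hornerXn. Qed.

Lemma pull_bimon (c : C) i j P S :
  pull (c%:P%:P * bimon i j) P S = c *: (P ^+ i * S ^+ j).
Proof.
rewrite /bimon !pullM !pullC comp_polyC mul_polyC; congr (_ *: (_ * _)).
  by rewrite comp_Xn_poly.
by rewrite /pull map_polyXn hornerXn.
Qed.

Lemma coef_bimon (c : C) i j i' j' :
  ((c%:P%:P * bimon i j)`_j')`_i' = c * ((i' == i) && (j' == j))%:R.
Proof.
rewrite /bimon !coefCM coefXn; case: (j' == j); last first.
  by rewrite mulr0 coef0 andbF mulr0.
by rewrite mulr1 coefXn andbT.
Qed.

(** If a point were missing, W would have fewer branches over p0 than the degree
    of q, and counting coefficients would give a nonzero g such that both g and
    its reflection g' in the unit circle vanish to a high order along all these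
    branches. Multiplied by h, which vanishes where d does, both g + g' and
    i (g - g') have real quotients by D over the circle, so that they are 0 by
    [real_quotient_eq0]. *)
Lemma full_fibre (d : {poly C}) p0 s0 : d != 0 -> d.[0] = 0 ->
  (forall p s, ev q p s = 0 -> d.[p] != 0 -> ev q^`() p s != 0) ->
  `|p0| < 1 -> d.[p0] != 0 -> ev q p0 s0 = 0 -> W (p0, s0).
Proof.
move=> d0 d_0 d_disc p01 dp0 qs0; apply: contrapT => nW.
have [rs rsE] := closed_field_poly_normal (fibre q p0).
rewrite (monicP (fibre_monic p0 q_monic)) scale1r in rsE.
have root_rs x : ev q p0 x = 0 -> x \in rs.
  by rewrite -root_prod_XsubC -rsE rootE fibreE => ->.
pose rs' := [seq x <- rs | `[< W (p0, x) >]].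
have sq : size q = (size rs).+1.
  by rewrite -(size_fibre p0 q_monic) rsE size_prod_XsubC.
have lt_rs' : (size rs' < size rs)%N.
  rewrite size_filter ltn_neqAle count_size andbT -all_count.
  apply/negP => /allP/(_ _ (root_rs _ qs0))/asboolP; exact: nW.
set n := size rs in sq lt_rs'; set n' := size rs' in lt_rs'.
(* There are n * L unknowns and 2 * n' * k.+1 equations; k is large enough for
   n' < n to give more unknowns than equations. The reflection sends p ^ i s ^ j
   to p ^ (N - i - j) s ^ j, and N + 2 e = 2 k makes h * g' / D the conjugate of
   h * g / D over the circle. *)
pose e := size d; pose k := (n * (2 * e + n + 2))%N.
pose N := (2 * k - 2 * e)%N; pose L := (N - n)%N.
have eN : (2 * e + N = 2 * k)%N by rewrite /N /k; nia.
have nL : (n + L = N)%N by rewrite /L /N /k; nia.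
have /choice[S SP] : forall x, exists S : {poly C}, W (p0, x) ->
    S.[0] = x /\ 'X^(k.+1) %| pull q ('X + p0%:P) S.
  move=> x.
  have [Wx|nWx] := pselect (W (p0, x)); last by exists 0.
  have qx := q_van Wx.
  by have [S [S1 S2]] := hensel k.+1 qx (d_disc _ _ qx dp0); exists S.
pose arc (r : 'I_n') := S (nth 0 rs' r).
pose a (x : 'I_n * 'I_L) (t : 'I_n' * 'I_k.+1 * bool) : C :=
  if t.2 then ((('X + p0%:P) ^+ (N - x.1 - x.2) * arc t.1.1 ^+ x.1)`_t.1.2)^*
  else (('X + p0%:P) ^+ x.2 * arc t.1.1 ^+ x.1)`_t.1.2.
have [|c [[x0 cx0] cE]] := kernel_ex a.
  by rewrite !card_prod !card_ord card_bool /L /N /k; nia.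
pose g := \sum_x (c x)%:P%:P * bimon x.2 x.1.
pose g' := \sum_x ((c x)^*)%:P%:P * bimon (N - x.1 - x.2) x.1.
have coefg j i : (g`_j)`_i = \sum_x c x * ((i == x.2) && (j == x.1))%:R.
  by rewrite coef_sum coef_sum; apply: eq_bigr => x _; rewrite coef_bimon.
have gj j : (n <= j)%N -> g`_j = 0.
  move=> nj; apply/polyP => i; rewrite coefg coef0 big1// => x _.
  by rewrite [j == _]gtn_eqF ?andbF ?mulr0// (leq_trans _ nj).
have g'j j : (n <= j)%N -> g'`_j = 0.
  move=> nj; apply/polyP => i; rewrite coef_sum coef_sum coef0 big1// => x _.
  by rewrite coef_bimon [j == _]gtn_eqF ?andbF ?mulr0// (leq_trans _ nj).
have g_neq0 : g != 0.
  apply: contraNneq cx0 => g0; have := coefg x0.1 x0.2.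
  rewrite g0 !coef0 (bigD1 x0)//= !eqxx mulr1 big1 ?addr0 => [->//|x xx0].
  rewrite !val_eqE; case: eqP => [h2|]; last by rewrite mulr0.
  case: eqP => [h1|]; last by rewrite mulr0.
  by move: xx0; rewrite [x]surjective_pairing -h1 -h2 -surjective_pairing eqxx.
have flat s : W (p0, s) -> exists r : 'I_n', arc r = S s.
  move=> Ws; have srs : s \in rs'.
    by rewrite mem_filter root_rs ?q_van// andbT; apply/asboolP.
  have sr : (index s rs' < n')%N by rewrite index_mem.
  by exists (Ordinal sr); rewrite /arc nth_index.
have pg (r : 'I_n') : 'X^(k.+1) %| pull g ('X + p0%:P) (arc r).
  apply: dvdp_Xn => i ik; rewrite pull_sum coef_sum.
  rewrite -[RHS](cE (r, Ordinal ik, false)); apply: eq_bigr => x _.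
  by rewrite pull_bimon coefZ.
have pg' (r : 'I_n') : 'X^(k.+1) %| pull g' ('X + p0%:P) (arc r).
  apply: dvdp_Xn => i ik; rewrite pull_sum coef_sum.
  have := congr1 (fun z => z^*) (cE (r, Ordinal ik, true)).
  rewrite rmorph0 rmorph_sum => E; rewrite -[RHS]E; apply: eq_bigr => x _.
  by rewrite pull_bimon coefZ /a /= rmorphM /= conjCK.
pose d' := reflect_poly e d; pose h := d * d'.
have h0 : h != 0.
  rewrite mulf_neq0//; apply: (contraNneq _ d0) => d'0.
  have := congr1 (fun x : {poly C} => x`_1) d'0.
  rewrite coef0 coef_poly ltnS /e size_poly_gt0 d0 subn1 => /eqP.
  by rewrite conjC_eq0 -lead_coefE lead_coef_eq0.
have hd p : d.[p] = 0 -> h.[p] = 0 by rewrite hornerM => ->; rewrite mul0r.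
pose D0 : {poly C} := (1 - (p0^* )%:P * 'X) ^+ k.
have D0E p : D0.[p] = (1 - p0^* * p) ^+ k.
  by rewrite horner_exp !hornerE.
pose D := ('X - p0%:P) ^+ k * D0.
have DE p : D.[p] = (p - p0) ^+ k * (1 - p0^* * p) ^+ k.
  by rewrite hornerM D0E horner_exp hornerXsubC.
have D0_disc p : `|p| <= 1 -> D0.[p] != 0.
  move=> p1; rewrite D0E expf_neq0// subr_eq0; apply/eqP => E.
  have : `|p0^* * p| < 1.
    by rewrite normrM norm_conjC (le_lt_trans _ p01)// ler_piMr.
  by rewrite -E normr1 ltxx.
have k0 : (0 < k)%N by rewrite /k muln_gt0 (leq_ltn_trans _ lt_rs')// addn2.
have hJ p : `|p| = 1 -> (h.[p])^* = p ^- (2 * e) * h.[p].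
  move=> p1; have pn0 : p != 0 by rewrite -normr_gt0 p1.
  rewrite hornerM horner_reflect ?leqnSn// !rmorphM /= conjCK rmorphXn /=.
  rewrite (conj_circle p1).
  by rewrite mul2n -addnn exprD exprVn; field; rewrite expf_neq0.
have DJ p : `|p| = 1 -> (D.[p])^* = p ^- (2 * k) * D.[p].
  move=> p1; have pn0 : p != 0 by rewrite -normr_gt0 p1.
  rewrite DE !rmorphM !rmorphXn !rmorphB !rmorphM /= conjCK rmorph1.
  rewrite (conj_circle p1).
  rewrite exprM -exprVn -!exprMn; congr (_ ^+ _).
  by field.
have gJ p s : `|p| = 1 -> s = p * s^* -> (ev g p s)^* = p ^- N * ev g' p s.
  move=> p1 ps; have pn0 : p != 0 by rewrite -normr_gt0 p1.
  have sJ : s^* = p^-1 * s by rewrite {2}ps mulKf.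
  rewrite !ev_sum rmorph_sum mulr_sumr; apply: eq_bigr => x _.
  rewrite !ev_bimon !rmorphM !rmorphXn /= sJ (conj_circle p1).
  have xN : (x.2 + x.1 <= N)%N.
    by rewrite -nL addnC leq_add// ltnW.
  have -> : p ^+ (N - x.1 - x.2) = p ^+ N / p ^+ x.1 / p ^+ x.2.
    rewrite -subnDA expfB_cond ?(negPf pn0) ?add0n 1?addnC// exprD.
    by field; rewrite !expf_neq0.
  by rewrite exprMn !exprVn; field; rewrite !expf_neq0.
have g'J p s : `|p| = 1 -> s = p * s^* -> (ev g' p s)^* = p ^- N * ev g p s.
  move=> p1 ps; have pn0 : p != 0 by rewrite -normr_gt0 p1.
  have := congr1 (fun z => z^*) (gJ p s p1 ps).
  rewrite conjCK rmorphM /= -exprVn rmorphXn /=.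
  rewrite conj_circle ?normfV ?p1 ?invr1// invrK => ->.
  by rewrite exprVn mulKf// expf_neq0.
have key F : (forall j, (n <= j)%N -> F`_j = 0) ->
    (forall r : 'I_n', 'X^(k.+1) %| pull F ('X + p0%:P) (arc r)) ->
    (forall p s, `|p| = 1 -> s = p * s^* -> (ev F p s)^* = p ^- N * ev F p s) ->
    F = 0.
  move=> Fj pF FJ; have : h%:P * F = 0.
    apply: (real_quotient_eq0 d0 d_disc p01 k0 D0_disc dp0 d_0).
    - rewrite sq ltnS; apply/leq_sizeP => j nj.
      by rewrite coefCM Fj// mulr0.
    - by move=> p s dp; rewrite evM evC hd// mul0r.
    - move=> p s p1 ps; apply: conj_real_Im; rewrite -/D.
      have pn0 : p != 0 by rewrite -normr_gt0 p1.
      have Dp : D.[p] != 0.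
        rewrite hornerM mulf_neq0// ?D0_disc ?p1// horner_exp hornerXsubC.
        rewrite expf_neq0// subr_eq0.
        by apply: contraTneq p01 => <-; rewrite p1 ltxx.
      rewrite evM evC fmorph_div rmorphM /= hJ// FJ// DJ// -eN exprD.
      by field; rewrite Dp !expf_neq0.
    - move=> s /[dup] Ws /SP[S1 S2]; exists (S s).
      split; [exact: S1|exact: S2|].
      have [r <-] := flat s Ws.
      by rewrite pullM; apply: dvdp_mull; exact: pF.
  by move=> /eqP; rewrite mulf_eq0 polyC_eq0 (negPf h0) => /eqP.
have gg' : g + g' = 0.
  apply: key.
  - by move=> j nj; rewrite coefD gj// g'j// addr0.
  - by move=> r; rewrite pullD; exact: dvdp_add (pg r) (pg' r).
  - move=> p s p1 ps; rewrite !evD rmorphD /= gJ// g'J//; ring.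
have : 'i%C%:P%:P * (g - g') = 0.
  apply: key.
  - by move=> j nj; rewrite coefCM coefB gj// g'j// subr0 mulr0.
  - move=> r; rewrite pullM pullB; apply: dvdp_mull.
    exact: dvdp_sub (pg r) (pg' r).
  - move=> p s p1 ps; rewrite !evM !evC !hornerC !evB rmorphM rmorphB /=.
    rewrite gJ// g'J//; have -> : ('i%C : C)^* = - 'i%C.
      by apply/eqP; rewrite eq_complex /= oppr0 !eqxx.
    ring.
move=> /eqP; rewrite mulf_eq0 !polyC_eq0 subr_eq0.
rewrite (negPf (neq0Ci _)) /= => /eqP g_g'.
move: g_neq0; rewrite -g_g' -mulr2n in gg'.
move=> /eqP; apply; apply/eqP; move/eqP: gg'.
by rewrite -mulr_natl mulf_eq0 -polyC_natr polyC_eq0 -polyC_natr polyC_eq0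
  pnatr_eq0.
Qed.

(** A root of a special fibre is a limit of roots of generic fibres, which are
    in W by [full_fibre]. *)
Lemma curve_over_disc p s : `|p| < 1 -> ev q p s = 0 -> W (p, s).
Proof.
move=> p1 qps; have [d [d0 d_0 d_disc]] := discriminant.
have up := ulim_shift p 1.
have [v vs qv] := root_lsc q_monic size_q up qps.
apply: (W_closed_near _ up vs p1).
have pn : U [set j | `|p + 1 / j.+1%:R| < 1].
  have e0 : 0 < 1 - `|p| by rewrite subr_gt0.
  apply: filterS (ulim_norm up e0) => j /=.
  move=> /(le_lt_trans (real_ler_norm _)); rewrite ltrBlDr subrK; apply.
  by rewrite rpredB ?normr_real.
apply: filterS2 pn (near_nonroot p (oner_neq0 _) d0) => j /= pj dj.
exact: (full_fibre d0 d_0 d_disc).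
Qed.
End MinimalPolynomial.

(** The curve q = 0 is the Zariski closure of W, by the last clause; passing to
    the closure adds no point over the open disc. *)
Theorem disc_curve : exists q : {poly {poly C}}, [/\ q \is monic, van q,
  forall p s, `|p| < 1 -> ev q p s = 0 -> W (p, s) &
  forall F, van F -> exists G, F = G * q].
Proof.
have [q [mq vq qmin]] := prime_ideal_min vanB vanMl W_prime van_polyC
  chi_monic chi_van.
exists q; split=> //; first exact: curve_over_disc.
exact: van_dvd.
Qed.

End PlaneCurve.

(** * Joint eigenvalues of a commuting pencil *)

Lemma common_eigenvector_in (K : numClosedFieldType) n (A B M : 'M[K]_n) a :
  comm_mx A B -> comm_mx M A -> comm_mx M B -> eigenvalue M a ->
  exists2 v : 'rV_n, v != 0 & [/\ v *m M = a *: v,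
    exists a1, v *m A = a1 *: v & exists a2, v *m B = a2 *: v].
Proof.
move=> AB MA MB Ma; pose V := eigenspace M a.
have V0 : (0 < \rank V)%N by rewrite lt0n mxrank_eq0.
have VA : stablemx V A by apply: comm_mx_stable_eigenspace.
have VB : stablemx V B by apply: comm_mx_stable_eigenspace.
have [|v v0 /andP[vA vB]] := common_eigenvector2
    (A := conjmx (row_base V) A) (B := conjmx (row_base V) B) V0.
  by rewrite -!conjmxM ?inE ?stablemx_row_base// AB.
exists (v *m row_base V); first by rewrite mulmx_free_eq0 ?row_base_free.
split; first by apply/eigenspaceP; rewrite mulmx_sub// eq_row_base.
  have /eigenvectorP[a1 /eigenspaceP wA] : stablemx (v *m row_base V) A.
    by rewrite -stablemx_restrict.
  by exists a1.
have /eigenvectorP[a2 /eigenspaceP wB] : stablemx (v *m row_base V) B.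
  by rewrite -stablemx_restrict.
by exists a2.
Qed.

Section Spectrum.
Variable R : realType.
Local Notation C := R[i].

Lemma notin_ex (r : seq C) : exists b, b \notin r.
Proof.
exists (1 + \sum_(x <- r) `|x|); apply/negP => rb.
set b := _ + _ in rb; have b1 : 0 <= b by rewrite addr_ge0// sumr_ge0.
have : `|b| <= \sum_(x <- r) `|x|.
  by rewrite (big_rem _ rb) /= lerDl sumr_ge0.
by rewrite ger0_norm// gerDr ler10.
Qed.

Lemma joint_spectrumP m (A B : 'M[C]_m) l : joint_spectrum A B l <->
  exists2 v : 'rV[C]_m, v != 0 & v *m A^T = l.1 *: v /\ v *m B^T = l.2 *: v.
Proof.
split=> [[v [v0 Av Bv]]|[v v0 [Av Bv]]].
  by exists v^T; rewrite ?trmx_eq0// -!trmx_mul Av Bv !linearZ.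
exists v^T; rewrite trmx_eq0 v0 -[A]trmxK -[B]trmxK -!trmx_mul Av Bv.
by rewrite !linearZ.
Qed.

Lemma joint_spectrum_comb m (A B : 'M[C]_m) l b : joint_spectrum A B l ->
  eigenvalue (A^T + b *: B^T) (l.1 + b * l.2).
Proof.
move=> /joint_spectrumP[v v0 [Av Bv]]; apply/eigenvalueP; exists v => //.
by rewrite mulmxDr -scalemxAr Av Bv scalerA scalerDl.
Qed.

(** The eigenspace of A^T + b B^T is stable under A^T and B^T, so it contains a
    common eigenvector. *)
Lemma eigenvalue_comb m (A B : 'M[C]_m) a b : comm_mx A B ->
  eigenvalue (A^T + b *: B^T) a ->
  exists2 l, joint_spectrum A B l & l.1 + b * l.2 = a.
Proof.
move=> AB; set M := _ + _ => Ma.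
have AB' : comm_mx A^T B^T by rewrite /comm_mx -!trmx_mul AB.
have [||w w0 [wM [a1 wA] [a2 wB]]] := common_eigenvector_in AB' _ _ Ma.
- by rewrite /comm_mx mulmxDr mulmxDl -scalemxAr -scalemxAl AB'.
- by rewrite /comm_mx mulmxDr mulmxDl -scalemxAr -scalemxAl AB'.
exists (a1, a2); first by apply/joint_spectrumP; exists w.
move: wM; rewrite mulmxDr -scalemxAr wA wB scalerA -scalerDl => /eqP.
by rewrite -subr_eq0 -scalerBl scaler_eq0 (negPf w0) orbF subr_eq0 => /eqP.
Qed.

(** Each of the finitely many joint eigenvalues other than l excludes at most
    one value of b. *)
Lemma separating_comb m (A B : 'M[C]_m) (l : C * C) : exists b, forall l',
  joint_spectrum A B l' -> l'.1 + b * l'.2 = l.1 + b * l.2 -> l' = l.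
Proof.
have [ra raE] := closed_field_poly_normal (char_poly A^T).
have [rb rbE] := closed_field_poly_normal (char_poly B^T).
have [b hb] := notin_ex [seq - (x - l.1) / (y - l.2) | x <- ra, y <- rb].
exists b => l' l'J E.
have l'a : l'.1 \in ra.
  have := joint_spectrum_comb 0 l'J; rewrite scale0r addr0 mul0r addr0.
  rewrite eigenvalue_root_char raE (monicP (char_poly_monic _)) scale1r.
  by rewrite root_prod_XsubC.
have l'b : l'.2 \in rb.
  have /joint_spectrumP[v v0 [_ Bv]] := l'J.
  have : eigenvalue B^T l'.2 by apply/eigenvalueP; exists v.
  rewrite eigenvalue_root_char rbE (monicP (char_poly_monic _)) scale1r.
  by rewrite root_prod_XsubC.
have E' : l'.1 - l.1 + b * (l'.2 - l.2) = 0.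
  by rewrite mulrBr addrACA E -opprD subrr.
have [e2|n2] := eqVneq l'.2 l.2.
  move: E'; rewrite e2 subrr mulr0 addr0 => /eqP; rewrite subr_eq0 => /eqP e1.
  by rewrite [l']surjective_pairing [l]surjective_pairing e1 e2.
move/negP: hb => []; apply/allpairsP; exists l'; split=> //=.
have n2' : l'.2 - l.2 != 0 by rewrite subr_eq0.
apply: (mulIf n2'); rewrite divfK//; apply/eqP.
by rewrite -subr_eq0 opprK addrC E'.
Qed.

Lemma eigenvalue_bound m (A : 'M[C]_m) a : eigenvalue A a ->
  `|a| <= \sum_i \sum_j `|A i j|.
Proof.
move=> /eigenvalueP[v va v0].
have [i vi0] := rV0Pn _ v0.
have [||k _ kmin] := seq_argmin (r := enum 'I_m) (f := fun j => - `|v 0 j|).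
- by move=> j; rewrite rpredN normr_real.
- by rewrite size_enum_ord (leq_ltn_trans _ (ltn_ord i)).
have kmax j : `|v 0 j| <= `|v 0 k| by rewrite -lerN2 kmin ?mem_enum.
have vk : 0 < `|v 0 k|.
  by rewrite (lt_le_trans _ (kmax i))// normr_gt0.
have := congr1 (fun w : 'rV_m => `|w 0 k|) va.
rewrite !mxE normrM => /esym E; rewrite -(ler_pM2r vk) E.
apply: le_trans (ler_norm_sum _ _ _) _; rewrite mulr_suml.
apply: ler_sum => j _.
rewrite normrM mulrC ler_pM// ?kmax//.
by rewrite (bigD1 k)//= lerDl sumr_ge0.
Qed.

(** The characteristic polynomial of A + p B, with coefficients in C[p]. The
    transposition turns the eigenvectors of [joint_spectrum], which are columns,
    into rows. *)
Definition pencil m (A B : 'M[C]_m) : {poly {poly C}} :=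
  char_poly (map_mx polyC A^T + 'X *: map_mx polyC B^T).

Lemma pencil_monic m (A B : 'M[C]_m) : pencil A B \is monic.
Proof. exact: char_poly_monic. Qed.

Lemma size_pencil m (A B : 'M[C]_m) : size (pencil A B) = m.+1.
Proof. exact: size_char_poly. Qed.

Lemma ev_pencil m (A B : 'M[C]_m) p s :
  ev (pencil A B) p s = 0 <-> eigenvalue (A^T + p *: B^T) s.
Proof.
rewrite eigenvalue_root_char -fibreE /fibre /pencil map_char_poly rootE.
have -> : map_mx (horner_eval p) (map_mx polyC A^T + 'X *: map_mx polyC B^T) =
    A^T + p *: B^T.
  by apply/matrixP => i j; rewrite !mxE /horner_eval !hornerE.
by split=> [->|/eqP].
Qed.

(** For |p| = 1 the matrix p^(-1/2) (B^t* + p B) is Hermitian, so p^(-1/2) s is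
    real. *)
Lemma pencil_circle m (B : 'M[C]_m) p s : `|p| = 1 ->
  ev (pencil (B^t* ) B) p s = 0 -> s = p * s^*.
Proof.
move=> p1 /ev_pencil/eigenvalueP[v vs v0].
have pp : p * p^* = 1 by rewrite -normCK p1 expr1n.
pose N := B^T; have BN : (B^t* )^T = N^t* by apply/matrixP => i j; rewrite !mxE.
pose c := (v *m N *m v^t*) 0 0; pose nu := (v *m v^t*) 0 0.
have cJ : (v *m N^t* *m v^t*) 0 0 = c^*.
  have -> : v *m N^t* *m v^t* = (v *m N *m v^t*)^t*.
    by rewrite !(trmx_mul, map_mxM) /= trmxCK mulmxA.
  by rewrite mxE mxE.
have nuE : nu = \sum_j `|v 0 j| ^+ 2.
  by rewrite /nu mxE; apply: eq_bigr => j _; rewrite !mxE normCK.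
have nuJ : nu^* = nu.
  rewrite nuE rmorph_sum; apply: eq_bigr => j _.
  by rewrite /= rmorphXn /= conj_normC.
have nu0 : nu != 0.
  have /rV0Pn[i vi] := v0; rewrite nuE psumr_neq0; last first.
    by move=> j _; rewrite exprn_ge0.
  by apply/hasP; exists i; rewrite ?mem_index_enum//= exprn_gt0// normr_gt0.
have E : c^* + p * c = s * nu.
  have := congr1 (fun w => (w *m v^t*) 0 0) vs.
  rewrite BN mulmxDr mulmxDl -scalemxAr -!scalemxAl mxE cJ.
  by rewrite [in X in _ + X]mxE [in RHS]mxE.
apply: (mulIf nu0); rewrite -E.
have := congr1 (fun z => p * z^*) E.
rewrite rmorphD !rmorphM /= conjCK nuJ mulrA => <-.
by rewrite mulrDr mulrA pp mul1r addrC.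
Qed.

End Spectrum.

(** * The symmetrized tridisc *)

Section Tridisc.
Variable R : realType.
Local Notation C := R[i].
Variable U : set_system nat.
Context {UU : UltraFilter U}.
Local Notation "u ~> l" := (ulim U u l) (at level 70).
Implicit Types (x : 'rV[C]_3).

Definition rlim n (y : nat -> 'rV[C]_n) (x : 'rV[C]_n) :=
  forall i, (fun j => y j 0 i) ~> x 0 i.

Definition cubic x (r : C) := r ^+ 3 - x 0 0 * r ^+ 2 + x 0 1 * r - x 0 2.

Lemma cubic_symmetrization (z : 'rV[C]_3) r :
  cubic (symmetrization z) r = (r - z 0 0) * (r - z 0 1) * (r - z 0 2).
Proof. by rewrite symmetrization3E /cubic !mxE /=; ring. Qed.

Lemma ord3P (P : 'I_3 -> Prop) : P 0 -> P 1 -> P 2 -> forall i, P i.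
Proof.
move=> P0 P1 P2 [[|[|[|//]]] hi].
- by rewrite (_ : Ordinal hi = 0)//; apply/val_inj.
- by rewrite (_ : Ordinal hi = 1)//; apply/val_inj.
- by rewrite (_ : Ordinal hi = 2)//; apply/val_inj.
Qed.

Lemma symmetrization3_surj x : exists z, symmetrization z = x.
Proof.
have [c] := @GRing.solve_monicpoly (R[i]) 3
  (nth 0 [:: x 0 2; - x 0 1; x 0 0]) isT.
rewrite !big_ord_recl big_ord0 /= => cE.
pose a := x 0 0 - c; pose b := x 0 1 - c * a.
pose t := sqrtC (a ^+ 2 - 4 * b).
have t2 : t ^+ 2 = a ^+ 2 - 4 * b by rewrite sqrtCK.
exists (\row_(i < 3) [:: c; (a + t) / 2; (a - t) / 2]`_i).
rewrite symmetrization3E; apply/rowP; apply: ord3P; rewrite !mxE /=.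
- by rewrite /a; field.
- transitivity (c * a + (a ^+ 2 - t ^+ 2) / 4); first by field.
  by rewrite t2 /b; field.
- transitivity (c * ((a ^+ 2 - t ^+ 2) / 4)); first by field.
  rewrite t2 /b /a.
  transitivity (c ^+ 3 - x 0 0 * c ^+ 2 + x 0 1 * c); first by field.
  by rewrite cE /bump /= ; ring.
Qed.

Lemma cubic_bound x r : cubic x r = 0 -> 1 <= `|r| ->
  `|r| <= `|x 0 0| + `|x 0 1| + `|x 0 2|.
Proof.
move=> cr r1; have r0 : 0 < `|r| by apply: lt_le_trans r1.
have r20 : 0 < `|r| ^+ 2 by rewrite exprn_gt0.
rewrite -(ler_pM2r r20) -exprS -normrX.
have -> : r ^+ 3 = x 0 0 * r ^+ 2 - x 0 1 * r + x 0 2.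
  by apply/eqP; rewrite -subr_eq0 -cr /cubic; apply/eqP; ring.
rewrite !mulrDl; apply: le_trans (ler_normD _ _) _; apply: lerD.
  apply: le_trans (ler_normB _ _) _; apply: lerD.
    by rewrite normrM normrX.
  by rewrite normrM ler_wpM2l// expr2 ler_peMl// ltW.
by rewrite ler_peMr// exprn_ege1.
Qed.

(** At a point outside G_3 the cubic has a root of modulus at least 1. Such
    roots stay bounded, and their limit would be a root of modulus at least 1 of
    the cubic at x. *)
Lemma GG3_open (y : nat -> 'rV[C]_3) x : GG R 3 x -> rlim y x ->
  U [set j | GG R 3 (y j)].
Proof.
move=> Gx yx; have [//|Gy] := ultra_em [set j | GG R 3 (y j)]; exfalso.
have /choice[r rP] : forall j, exists r, ~ GG R 3 (y j) ->
    cubic (y j) r = 0 /\ 1 <= `|r|.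
  move=> j; have [z zE] := symmetrization3_surj (y j).
  have [zD|/existsNP[i /negP zi]] := pselect (polydisc R 3 z).
    by exists 0 => nG; exfalso; apply: nG; exists z.
  exists (z 0 i) => _; rewrite real_ltNge ?normr_real// negbK in zi.
  split=> //; rewrite -zE cubic_symmetrization.
  by move: i {zi}; apply: ord3P; rewrite subrr ?(mulr0, mul0r).
have bnd i : U [set j | `|y j 0 i| <= `|x 0 i| + 1].
  apply: filterS (ulim_norm (yx i) ltr01) => j /= h.
  have := le_lt_trans (real_ler_norm _) h; rewrite ltrBlDl => h'.
  by apply/ltW/h'; rewrite rpredB ?normr_real.
have [s rs] : exists s, r ~> s.
  apply: (@ulim_ex_near _ _ _ _
    ((`|x 0 0| + 1) + (`|x 0 1| + 1) + (`|x 0 2| + 1))).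
  apply: filterS2 Gy (filterI (bnd 0) (filterI (bnd 1) (bnd 2))).
  move=> j /= /rP[r1 r2] [b0 [b1 b2]].
  by apply: le_trans (cubic_bound r1 r2) _; rewrite !lerD.
have s1 : ~ (`|s| < 1).
  move=> s1; have e0 : 0 < 1 - `|s| by rewrite subr_gt0.
  have [j /= h /rP[_ rj]] := ultra_and (ulim_norm rs e0) Gy.
  have := le_lt_trans (real_ler_norm _) h; rewrite ltrBlDr subrK => /(_ _).
  by rewrite rpredB ?normr_real// => /(_ isT) /(le_lt_trans rj); rewrite ltxx.
have cs : cubic x s = 0.
  have h : (fun j => cubic (y j) (r j)) ~> cubic x s.
    apply: ulimB => //; apply: ulimD; last exact: ulimM.
    apply: ulimB; first exact: ulimX.
    by apply: ulimM => //; exact: ulimX.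
  apply: (ulim_uniq h); apply: ulim_near (ulim_cst 0).
  by apply: filterS Gy => j /= /rP[->].
have [z zD zE] := Gx; move: cs; rewrite -zE cubic_symmetrization => /eqP.
rewrite !mulf_eq0 !subr_eq0 -orbA.
by move=> /or3P[]/eqP sz; apply: s1; rewrite sz; exact: zD.
Qed.

Lemma rlim_symmetrization3 (z : nat -> 'rV[C]_3) w : rlim z w ->
  rlim (fun j => symmetrization (z j)) (symmetrization w).
Proof.
move=> zw.
have h i : (fun j => symmetrization (z j) 0 i) =
   (fun j => [:: z j 0 0 + z j 0 1 + z j 0 2;
                   z j 0 0 * z j 0 1 + z j 0 1 * z j 0 2 + z j 0 2 * z j 0 0;
                   z j 0 0 * z j 0 1 * z j 0 2]`_i).
  by apply/funext => j; rewrite symmetrization3E mxE.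
move=> i; rewrite h symmetrization3E mxE.
move: i; apply: ord3P => /=.
- exact: ulimD (ulimD (zw 0) (zw 1)) (zw 2).
- apply: ulimD; last exact: ulimM (zw 2) (zw 0).
  exact: ulimD (ulimM (zw 0) (zw 1)) (ulimM (zw 1) (zw 2)).
- exact: ulimM (ulimM (zw 0) (zw 1)) (zw 2).
Qed.

Lemma GG3_lim (y : nat -> 'rV[C]_3) : (forall j, GG R 3 (y j)) ->
  exists2 x, rlim y x & Gamma R 3 x.
Proof.
move=> Gy; have /choice[z zP] : forall j, exists z,
    polydisc R 3 z /\ symmetrization z = y j.
  by move=> j; have [z] := Gy j; exists z.
have /choice[w wP] : forall i, exists l, (fun j => z j 0 i) ~> l.
  by move=> i; apply: (@ulim_ex _ _ _ _ 1) => j; rewrite ltW//; case: (zP j).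
exists (symmetrization (\row_i w i)).
  have zw : rlim z (\row_i w i) by move=> i; rewrite mxE.
  move=> i; apply: ulim_near (rlim_symmetrization3 zw i).
  by apply: filterE => j /=; case: (zP j) => _ ->.
exists (\row_i w i) => // i; rewrite mxE.
apply: (ulim_le _ (wP i)) => //; apply: filterE => j /=.
by rewrite ltW//; case: (zP j).
Qed.

Lemma ulim_meval n (f : mpoly.mpoly n C) (y : nat -> 'rV[C]_n) (x : 'rV[C]_n) :
  rlim y x -> (fun j => mpoly.meval (y j 0) f) ~> mpoly.meval (x 0) f.
Proof.
move=> yx; rewrite mpoly.mevalE.
apply: ulim_near; first by apply: filterE => j /=; rewrite mpoly.mevalE.
apply: ulim_sum => m; apply: ulimM; first exact: ulim_cst.
by apply: ulim_prod => i; apply: ulimX.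
Qed.

Lemma GG3_p_lt1 x : GG R 3 x -> `|x 0 2| < 1.
Proof.
move=> [z zD <-]; rewrite symmetrization3E mxE /= !normrM.
by rewrite mulr_ilt1 ?mulr_ge0// mulr_ilt1.
Qed.

Lemma bGamma3_p1 x : bGamma R 3 x -> `|x 0 2| = 1.
Proof.
by move=> [z zT <-]; rewrite symmetrization3E mxE /= !normrM !zT !mulr1.
Qed.

(** The limit is in V and Gamma_3. If it were not in G_3, it would be in the
    distinguished boundary by hypothesis, hence have |p| = 1. *)
Lemma distinguished_lim (L V : set 'rV[C]_3) (y : nat -> 'rV[C]_3) :
  algebraic_set V -> L = GG R 3 `&` V ->
  (V `&` Gamma R 3) `&` dGamma R 3 = (V `&` Gamma R 3) `&` bGamma R 3 ->
  (forall j, L (y j)) -> exists2 x, rlim y x & `|x 0 2| < 1 -> L x.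
Proof.
move=> [I VE] LE bd Ly.
have [j|x yx Gx] := @GG3_lim y; first by have := Ly j; rewrite LE => -[].
exists x => // x1.
have Vx : V x.
  rewrite VE => f If; apply: (ulim_uniq (ulim_meval f yx)).
  apply: ulim_near (ulim_cst 0); apply: filterE => j /=.
  by have := Ly j; rewrite LE VE => -[_ /(_ f If)].
rewrite LE; split=> //; apply: contrapT => nGx.
have : ((V `&` Gamma R 3) `&` dGamma R 3) x by [].
by rewrite bd => -[_ /bGamma3_p1 E]; rewrite E ltxx in x1.
Qed.

End Tridisc.

(** * Polynomial maps *)

Import -(notations) mpoly.

Section PolyMaps.
Variable R : realType.
Local Notation C := R[i].

Lemma ex_mpoly_ev n (F : {poly {poly C}}) (P S : mpoly n C) :
  exists f, forall v, meval v f = ev F (meval v P) (meval v S).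
Proof.
have exc (c : {poly C}) : exists f, forall v, meval v f = c.[meval v P].
  elim/poly_ind: c => [|c a [f fE]].
    by exists 0 => v; rewrite meval0 horner0.
  exists (f * P + mpolyC n a) => v.
  by rewrite mevalD mevalM mevalC fE !hornerE.
elim/poly_ind: F => [|F c [f fE]]; first by exists 0 => v; rewrite meval0 ev0.
have [g gE] := exc c; exists (f * S + g) => v.
by rewrite mevalD mevalM fE gE !evE.
Qed.

Lemma ex_ev_mpoly (f : mpoly 2 C) : exists F : {poly {poly C}},
  forall x : 'rV[C]_2, meval (x 0) f = ev F (x 0 1) (x 0 0).
Proof.
exists (\sum_(m <- msupp f)
  (mcoeff m f *: 'X^(m (1 : 'I_2)))%:P * 'X^(m (0 : 'I_2))) => x.
rewrite mevalE ev_sum; apply: eq_bigr => m _.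
rewrite !evE hornerZ hornerXn !big_ord_recl big_ord0 mulr1 -mulrA.
rewrite (_ : lift ord0 ord0 = 1); last exact/val_inj.
by congr (_ * _); rewrite mulrC.
Qed.

Lemma phiE (x : 'rV[C]_3) :
  phi x 0 0 = x 0 0 / 3 + x 0 1 / 3 /\ phi x 0 1 = x 0 2.
Proof. by rewrite /phi !mxE. Qed.

Lemma ex_mpoly_phi (F : {poly {poly C}}) : exists f : mpoly 3 C,
  forall x : 'rV[C]_3, meval (x 0) f = ev F (phi x 0 1) (phi x 0 0).
Proof.
have [f fE] := ex_mpoly_ev F (mpolyX _ (mnm1 (2 : 'I_3)))
  (mpolyC 3 (3^-1) * mpolyX _ (mnm1 (0 : 'I_3))
  + mpolyC 3 (3^-1) * mpolyX _ (mnm1 (1 : 'I_3))).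
exists f => x; rewrite fE mevalD !mevalM !mevalC !mevalXU.
by case: (phiE x) => -> ->; rewrite ![_ / 3]mulrC.
Qed.

Lemma algebraic_phi_preimage (A : set 'rV[C]_2) : algebraic_set A ->
  algebraic_set (@phi R @^-1` A).
Proof.
move=> [I AE].
exists [set g | exists2 f, I f & forall x : 'rV[C]_3,
  meval (x 0) g = meval (phi x 0) f].
apply/seteqP; split=> x /=.
  by rewrite AE => Ax g [f If gE]; rewrite gE; apply: Ax.
move=> h; rewrite AE => f If.
have [F FE] := ex_ev_mpoly f; have [g gE] := ex_mpoly_phi F.
have gf (y : 'rV[C]_3) : meval (y 0) g = meval (phi y 0) f by rewrite gE FE.
by rewrite -gf; apply: h; exists f.
Qed.

Lemma algebraic_ev_zero (F : {poly {poly C}}) :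
  algebraic_set [set x : 'rV[C]_2 | ev F (x 0 1) (x 0 0) = 0].
Proof.
have [f fE] := ex_mpoly_ev F (mpolyX _ (mnm1 (1 : 'I_2)))
  (mpolyX _ (mnm1 (0 : 'I_2))).
have {}fE (x : 'rV[C]_2) : meval (x 0) f = ev F (x 0 1) (x 0 0).
  by rewrite fE !mevalXU.
exists [set f]; apply/seteqP; split=> x /=.
  by move=> Fx _ ->; rewrite fE.
by move=> /(_ f erefl); rewrite fE.
Qed.

Lemma algebraic_point (a : 'rV[C]_2) : algebraic_set [set a].
Proof.
exists [set mpolyX _ (mnm1 i) - mpolyC 2 (a 0 i) | i in [set: 'I_2]].
apply/seteqP; split=> x /=.
  by move=> -> _ [i _ <-]; rewrite mevalB mevalXU mevalC subrr.
move=> h; apply/rowP => i; apply/eqP; rewrite -subr_eq0; apply/eqP.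
by rewrite -(h _ (ex_intro2 _ _ i Logic.I erefl)) mevalB mevalXU mevalC.
Qed.

Lemma irreducible_point n (a : 'rV[C]_n) : zariski_irreducible [set a].
Proof.
split=> [|A B _ _ /(_ a erefl)[]]; first by exists a.
  by left=> _ ->.
by right=> _ ->.
Qed.

Lemma irreducible_phi (L : set 'rV[C]_3) : zariski_irreducible L ->
  zariski_irreducible (@phi R @` L).
Proof.
move=> [[x Lx] Lirr]; split; first by exists (phi x), x.
move=> A B Aalg Balg LAB.
have [|LA|LB] := Lirr _ _ (algebraic_phi_preimage Aalg)
  (algebraic_phi_preimage Balg).
- by move=> y Ly; apply: LAB; exists y.
- by left=> _ [y Ly <-]; apply: LA.
- by right=> _ [y Ly <-]; apply: LB.
Qed.

Lemma irreducible_van_prime (L : set 'rV[C]_2) (F G : {poly {poly C}}) :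
  zariski_irreducible L ->
  (forall x, L x -> ev (F * G) (x 0 1) (x 0 0) = 0) ->
  (forall x, L x -> ev F (x 0 1) (x 0 0) = 0) \/
  (forall x, L x -> ev G (x 0 1) (x 0 0) = 0).
Proof.
move=> [_ Lirr] FG.
have [|LF|LG] := Lirr _ _ (algebraic_ev_zero F) (algebraic_ev_zero G).
- move=> x Lx; have /eqP := FG x Lx; rewrite evM mulf_eq0.
  by move=> /orP[]/eqP; [left|right].
- by left.
- by right.
Qed.

Lemma irreducible_closure n (L V : set 'rV[C]_n) : zariski_irreducible L ->
  L `<=` V -> (forall A, algebraic_set A -> L `<=` A -> V `<=` A) ->
  zariski_irreducible V.
Proof.
move=> [[x Lx] Lirr] LV VA; split; first by exists x; apply: LV.
move=> A B Aalg Balg VAB.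
have [|LA|LB] := Lirr A B Aalg Balg; first by move=> y /LV/VAB.
  by left; apply: VA.
by right; apply: VA.
Qed.

Lemma alg_dim_gt0 (V : set 'rV[C]_2) a b : algebraic_set V ->
  zariski_irreducible V -> V a -> V b -> a <> b -> (0 < alg_dim V)%E.
Proof.
move=> Valg Virr Va Vb ab; apply: (@lt_le_trans _ _ 1%E); first exact: lte01.
apply: ereal_sup_ubound; exists 1%N => //.
exists (fun i => if i is 0%N then [set a] else V); split.
  case=> [|i] _; last by split.
  by split; [exact: algebraic_point|exact: irreducible_point|move=> _ ->].
case=> // _; split; first by move=> _ ->.
by move=> /(_ b Vb) /= ba; apply: ab.
Qed.

End PolyMaps.

(** * The variety of joint eigenvalues *)

Section LambdaSet.
Variable R : realType.
Local Notation C := R[i].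
Variable U : set_system nat.
Context {UU : UltraFilter U}.
Local Notation "u ~> l" := (ulim U u l) (at level 70).
Variables (m : nat) (F1 F2 : 'M[C]_m).
Hypothesis hcomm : forall p : C, comm_mx (F1 ^t* + p *: F2) (F2 ^t* + p *: F1).

Let A p := F1 ^t* + p *: F2.
Let B p := F2 ^t* + p *: F1.

(** The curve of the values of s1 + b s2 on the joint spectrum. *)
Let Q b := pencil (F1 ^t* + b *: F2 ^t* ) (F2 + b *: F1).

Lemma ev_combP b p s :
  ev (Q b) p s = 0 <-> eigenvalue ((A p)^T + b *: (B p)^T) s.
Proof.
rewrite ev_pencil; have -> // : (F1^t* + b *: F2^t*)^T + p *: (F2 + b *: F1)^T =
  (A p)^T + b *: (B p)^T.
have trE (M N : 'M[C]_m) c : (M + c *: N)^T = M^T + c *: N^T.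
  by rewrite linearD linearZ.
by rewrite !trE !scalerDr addrACA !scalerA [p * b]mulrC.
Qed.

(** If s1 + b s2 separates l from the other joint eigenvalues at p, the root of
    Q b that follows l.1 + b * l.2 comes from joint eigenvalues. Their limit is
    a joint eigenvalue at p with the same value of s1 + b s2, hence it is l. *)
Lemma joint_spectrum_follow p l u : joint_spectrum (A p) (B p) l -> u ~> p ->
  exists y : nat -> C * C,
    [/\ forall j, joint_spectrum (A (u j)) (B (u j)) (y j),
        (fun j => (y j).1) ~> l.1 & (fun j => (y j).2) ~> l.2].
Proof.
move=> lJ up; have [b bP] := separating_comb (A p) (B p) l.
have sQ b' : (1 < size (Q b'))%N.
  rewrite size_pencil ltnS; have /joint_spectrumP[v /rV0Pn[i _] _] := lJ.
  exact: leq_ltn_trans (ltn_ord i).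
have Ql : ev (Q b) p (l.1 + b * l.2) = 0 by apply/ev_combP/joint_spectrum_comb.
have [w wl Qw] := root_lsc (pencil_monic _ _) (sQ b) up Ql.
have /choice[y yP] : forall j, exists y, joint_spectrum (A (u j)) (B (u j)) y /\
    y.1 + b * y.2 = w j.
  move=> j; have /ev_combP/(eigenvalue_comb (hcomm _))[y y1 y2] := Qw j.
  by exists y.
have lim_entry (M N : 'M[C]_m) : exists k, U [set j |
    \sum_i \sum_i' `|((M + u j *: N)^T) i i'| <= k].
  have h : (fun j => \sum_i \sum_i' `|((M + u j *: N)^T) i i'|) ~>
      \sum_i \sum_i' `|((M + p *: N)^T) i i'|.
    apply: ulim_sum => i; apply: ulim_sum => i'; apply: ulim_norm.
    rewrite !mxE; apply: ulim_near.
      by apply: filterE => j /=; rewrite !mxE.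
    by apply: ulimD; [exact: ulim_cst|apply: ulimM => //; exact: ulim_cst].
  have [k _ kP] := ulim_bounded h; exists k; apply: filterS kP => j /=.
  rewrite ger0_norm; first exact: ltW.
  by apply: sumr_ge0 => i _; apply: sumr_ge0.
have eA l' p' : joint_spectrum (A p') (B p') l' -> eigenvalue (A p')^T l'.1.
  by move=> /(joint_spectrum_comb 0); rewrite scale0r addr0 mul0r addr0.
have eB l' p' : joint_spectrum (A p') (B p') l' -> eigenvalue (B p')^T l'.2.
  by move=> /joint_spectrumP[v v0 [_ vB]]; apply/eigenvalueP; exists v.
have [a ya] : exists a, (fun j => (y j).1) ~> a.
  have [k kP] := lim_entry (F1 ^t* ) F2.
  apply: ulim_ex_near (_ : U [set j | _ <= k]).
  apply: filterS kP => j /=; apply: le_trans; apply: eigenvalue_bound.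
  exact: eA (yP j).1.
have [c yc] : exists c, (fun j => (y j).2) ~> c.
  have [k kP] := lim_entry (F2 ^t* ) F1.
  apply: ulim_ex_near (_ : U [set j | _ <= k]).
  apply: filterS kP => j /=; apply: le_trans; apply: eigenvalue_bound.
  exact: eB (yP j).1.
have lim_comb b' : (fun j => (y j).1 + b' * (y j).2) ~> a + b' * c.
  by apply: ulimD => //; apply: ulimM => //; exact: ulim_cst.
have acJ : joint_spectrum (A p) (B p) (a, c).
  have [b' b'P] := separating_comb (A p) (B p) (a, c).
  have : ev (Q b') p (a + b' * c) = 0.
    apply: (ulim_uniq (ulim_ev (Q b') up (lim_comb b'))).
    apply: ulim_near (ulim_cst 0); apply: filterE => j /=.
    by symmetry; apply/ev_combP/joint_spectrum_comb; exact: (yP j).1.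
  by move=> /ev_combP/(eigenvalue_comb (hcomm _))[l' l'J /(b'P _ l'J) <-].
have acl : (a, c) = l.
  apply: bP => //; apply: (ulim_uniq (lim_comb b)).
  by apply: ulim_near wl; apply: filterE => j /=; case: (yP j).
by exists y; rewrite -acl; split=> // j; case: (yP j).
Qed.

Lemma Lambda_follow x u : Lambda F1 F2 x -> u ~> x 0 2 ->
  exists2 y, rlim U y x & U [set j | Lambda F1 F2 (y j) /\ y j 0 2 = u j].
Proof.
move=> [Gx xJ] ux; have [y [yJ y1 y2]] := joint_spectrum_follow xJ ux.
pose z j : 'rV[C]_3 := \row_(i < 3) [:: (y j).1; (y j).2; u j]`_i.
have zE j : [/\ z j 0 0 = (y j).1, z j 0 1 = (y j).2 & z j 0 2 = u j].
  by rewrite /z !mxE.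
have zx : rlim U z x.
  by apply: ord3P;
    [apply: ulim_near y1|apply: ulim_near y2|apply: ulim_near ux];
    apply: filterE => j /=; case: (zE j) => E0 E1 E2; rewrite ?E0 ?E1 ?E2.
exists z => //; apply: filterS (GG3_open Gx zx) => j /= Gz.
have [z0 z1 z2] := zE j; split=> //; split=> //.
by rewrite z0 z1 z2 -surjective_pairing; exact: yJ.
Qed.

(** One third of the sum of the two pencils; s1 / 3 + s2 / 3 is one of its
    eigenvalues. *)
Definition phi_pencil : {poly {poly C}} :=
  pencil ((3^-1 *: (F1 + F2)) ^t* ) (3^-1 *: (F1 + F2)).

Lemma ev_phi_pencil x : Lambda F1 F2 x ->
  ev phi_pencil (phi x 0 1) (phi x 0 0) = 0.
Proof.
move=> [_ /(joint_spectrum_comb 1)/eigenvalueP[v /= vE v0]].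
have [-> ->] := phiE x; apply/ev_pencil/eigenvalueP; exists v => //.
have -> : ((3^-1 *: (F1 + F2)) ^t* )^T + x 0 2 *: (3^-1 *: (F1 + F2))^T =
    3^-1 *: ((F1 ^t* + x 0 2 *: F2)^T + 1 *: (F2 ^t* + x 0 2 *: F1)^T).
  apply/matrixP => i j; rewrite !mxE rmorphM rmorphD fmorphV rmorph_nat /=.
  by ring.
by rewrite -scalemxAr vE scalerA mul1r mulrDr ![3^-1 * _]mulrC.
Qed.

End LambdaSet.

Theorem theorem4p3 (R : realType) (m : nat) (F1 F2 : 'M[R[i]]_m)
    (hcomm : forall p : R[i],
       comm_mx (F1 ^t* + p *: F2) (F2 ^t* + p *: F1))
    (hLambda : distinguished_variety (Lambda F1 F2)) :
  distinguished_variety [set phi x | x in Lambda F1 F2].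
Proof.
have [[V [Valg _ LE bd]] Lirr] := hLambda.
have [U [UU leU]] : exists U, UltraFilter U /\ eventually `<=` U.
  by apply: ultraFilterLemma.
have Pirr := irreducible_phi Lirr.
set P := [set phi x | x in _] in Pirr *.
pose W : set (R[i] * R[i]) := [set z | exists2 y, P y & z = (y 0 1, y 0 0)].
have vanP F : van W F <-> forall y, P y -> ev F (y 0 1) (y 0 0) = 0.
  split=> [vF y Py|PF p s [y Py [-> ->]]]; last exact: PF.
  by apply: vF; exists y.
have PG y : P y -> GG R 2 y by move=> [x [Gx _] <-]; apply: phi_GG.
have W_disc p s : W (p, s) -> `|p| < 1.
  move=> [_ [x [Gx _] <-] [-> _]]; rewrite (phiE x).2; exact: GG3_p_lt1 Gx.
have W_bounded : exists M : R[i], forall p s, W (p, s) -> `|s| <= M.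
  exists 2 => p s [y /PG[z zD <-] [_ ->]]; rewrite symmetrization2E mxE /=.
  by apply: le_trans (ler_normD _ _) _; rewrite (_ : 2 = 1 + 1)// lerD// ltW.
have W_closed u v p s : (forall j, W (u j, v j)) ->
    ulim U u p -> ulim U v s -> `|p| < 1 -> W (p, s).
  move=> Wuv up vs p1.
  have /choice[x xP] : forall j, exists x, [/\ Lambda F1 F2 x,
      u j = phi x 0 1 & v j = phi x 0 0].
    by move=> j; have [_ [x Lx <-] [-> ->]] := Wuv j; exists x.
  have [|x0 xx0 x0L] := distinguished_lim Valg LE bd (y := x).
    by move=> j; case: (xP j).
  have pE : p = phi x0 0 1.
    apply: (ulim_uniq up); rewrite (phiE x0).2.
    apply: ulim_near (xx0 2); apply: filterE => j /=.
    by case: (xP j) => _ -> _; rewrite (phiE _).2.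
  have sE : s = phi x0 0 0.
    apply: (ulim_uniq vs); rewrite (phiE x0).1.
    have h : ulim U (fun j => x j 0 0 / 3 + x j 0 1 / 3)
        (x0 0 0 / 3 + x0 0 1 / 3).
      by apply: ulimD; apply: ulimM => //; exact: ulim_cst.
    apply: ulim_near h; apply: filterE => j /=.
    by case: (xP j) => _ _ ->; rewrite (phiE _).1.
  exists (phi x0); last by rewrite pE sE.
  by exists x0 => //; apply: x0L; rewrite -(phiE x0).2 -pE.
have W_open u p s : W (p, s) -> ulim U u p ->
    exists2 v, ulim U v s & U [set j | W (u j, v j)].
  move=> [_ [x Lx <-] [-> ->]]; rewrite (phiE x).2 (phiE x).1 => up.
  have [y yx Ly] := Lambda_follow hcomm Lx up.
  exists (fun j => y j 0 0 / 3 + y j 0 1 / 3).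
    by apply: ulimD; apply: ulimM => //; exact: ulim_cst.
  apply: filterS Ly => j /= [Lj <-]; exists (phi (y j)); first by exists (y j).
  by rewrite (phiE _).1 (phiE _).2.
have W0 : W !=set0 by have [[y Py] _] := Pirr; exists (y 0 1, y 0 0), y.
have W_prime F G : van W (F * G) -> van W F \/ van W G.
  by move=> /vanP/(irreducible_van_prime Pirr)[]/vanP; [left|right].
have chi_van : van W (phi_pencil F1 F2).
  by apply/vanP => _ [x Lx <-]; exact: ev_phi_pencil.
have [q [q_monic q_van qW q_dvd]] := disc_curve leU W_disc W_bounded W_closed
  W_open W0 W_prime (pencil_monic _ _) chi_van (@pencil_circle _ _ _).
pose V2 := [set y : 'rV[R[i]]_2 | ev q (y 0 1) (y 0 0) = 0].
have V2alg : algebraic_set V2 by exact: algebraic_ev_zero.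
have PV2 : P `<=` V2 by move=> y Py; move/vanP: q_van; apply.
have V2P y : V2 y -> `|y 0 1| < 1 -> P y.
  move=> Vy y1; have [y' Py' [E1 E0]] := qW _ _ y1 Vy.
  suff -> : y = y' by [].
  apply/rowP => -[[|[|//]] hi].
    by rewrite (_ : Ordinal hi = 0)//; apply/val_inj.
  by rewrite (_ : Ordinal hi = 1)//; apply/val_inj.
have V2irr : zariski_irreducible V2.
  apply: (irreducible_closure Pirr PV2) => A [I AE] PA y Vy.
  rewrite AE => f If; have [F FE] := ex_ev_mpoly f.
  have [|G FG] := q_dvd F; last by rewrite FE FG evM Vy mulr0.
  by apply/vanP => z /PA; rewrite AE -FE; apply.
split=> //; exists V2; split=> //.
(* The dimension is positive because W has points over infinitely many p. *)
- have [[a Pa] _] := Pirr.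
  have Wa : W (a 0 1, a 0 0) by exists a.
  have [v _ Wv] := W_open _ _ _ Wa (ulim_shift leU (a 0 1) 1).
  have [j [b Pb [E _]]] := ultra_ex Wv.
  apply: (alg_dim_gt0 V2alg V2irr (PV2 _ Pa) (PV2 _ Pb)) => ab.
  move/eqP: E; rewrite ab -subr_eq0 addrAC subrr add0r.
  by rewrite mul1r invr_eq0 pnatr_eq0.
- apply/seteqP; split=> y; first by move=> Py; split; [exact: PG|exact: PV2].
  move=> [[z zD <-] Vy]; apply: V2P => //.
  by rewrite symmetrization2E mxE /= normrM mulr_ilt1.
apply/seteqP; split=> y [[Vy Gy]] => [[_ nGy]|by1]; split=> //.
- have [z zD zE] := Gy; exists z => //.
  have y1E : y 0 1 = z 0 0 * z 0 1 by rewrite -zE symmetrization2E mxE.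
  have y1 : ~ (`|y 0 1| < 1) by move=> y1; apply: nGy; apply: PG; apply: V2P.
  have z1 i : `|z 0 i| <= 1 by apply: zD.
  have zz i i' : `|z 0 i| < 1 -> `|z 0 i * z 0 i'| < 1.
    by move=> zi; rewrite normrM (le_lt_trans _ zi)// ler_piMr.
  move=> [[|[|//]] hi]; apply/eqP; rewrite eq_le zD /= real_leNgt ?normr_real//;
    apply/negP => h; apply: y1; rewrite y1E.
    by apply: zz; move: h; rewrite (_ : Ordinal hi = 0)//; apply/val_inj.
  rewrite mulrC; apply: zz.
  by move: h; rewrite (_ : Ordinal hi = 1)//; apply/val_inj.
- split=> // -[z zD zE]; have [w wT wE] := by1.
  have : `|y 0 1| < 1 by rewrite -zE symmetrization2E mxE /= normrM mulr_ilt1.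
  by rewrite -wE symmetrization2E mxE /= normrM !wT mulr1 ltxx.
Qed.
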